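(* Let $(X_i)_{i\ge 1}$ be independent identically distributed real random variables with mean $0$ and variance $1$, and assume that there is $p>2$ with $\mathbb{E}|X_1|^p<\infty$. For $i\in\mathbb{N}^+$ let $\overline{X}_i:=(X_1+X_2+\cdots+X_i)/i$, and for $n\in\mathbb{N}^+$ let $M_n:=\sup\{\overline{X}_i : i\ge n\}$. Then, as $n\to\infty$, $$\sqrt{n}\,M_n\Rightarrow |Z|,$$ where $Z\sim N(0,1)$ is a standard normal random variable.
   Context: $\mathbb{N}^+=\{1,2,3,\ldots\}$. The symbol $\Rightarrow$ denotes convergence in distribution (weak convergence). *)

(* Defs.v *)
From HB Require Import structures.
From mathcomp Require Import all_boot all_order all_algebra finmap.
From mathcomp Require Import all_classical all_reals all_analysis.
From mathcomp Require Import measurable_realfun.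

Set Implicit Arguments.
Unset Strict Implicit.
Unset Printing Implicit Defensive.

Import Order.TTheory GRing.Theory Num.Theory.
Import numFieldNormedType.Exports.

Local Open Scope classical_set_scope.
Local Open Scope ring_scope.

Definition mutually_independent d (T : measurableType d) (R : realType)
    (P : probability T R) (X : nat -> {RV P >-> R}) : Prop :=
  forall (J : {fset nat}) (A : nat -> set R), (forall i, measurable (A i)) ->
    P (\bigcap_(i in [set` J]) (X i @^-1` A i)) =
    (\prod_(i <- J) P (X i @^-1` A i))%E.

Definition identically_distributed d (T : measurableType d) (R : realType)
    (P : probability T R) (X : nat -> {RV P >-> R}) : Prop :=
  forall (i j : nat) (A : set R), measurable A ->
    distribution P (X i) A = distribution P (X j) A.

(* [normal_prob m s] takes the standard deviation [s], not the variance. *)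
Definition standard_normal d (T : measurableType d) (R : realType)
    (P : probability T R) (Z : {RV P >-> R}) : Prop :=
  forall A : set R, measurable A -> distribution P Z A = normal_prob 0 1 A.

(* The limit may live on a different probability space. *)
Definition cvg_in_distribution d (T : measurableType d) (R : realType)
    (P : probability T R) d' (T' : measurableType d') (P' : probability T' R)
    (Y : nat -> {RV P >-> R}) (Y' : {RV P' >-> R}) : Prop :=
  forall f : R -> R, continuous f -> bounded_fun f ->
    ('E_P[f \o Y n] @[n --> \oo] --> 'E_P'[f \o Y'])%E.

(* Sequences of random variables are indexed from 0: [X k] plays the role of
   X_{k+1}, so that [sample_mean X i] is the mean of X_1, ..., X_i. *)
Definition sample_mean d (T : measurableType d) (R : realType)
    (P : probability T R) (X : nat -> {RV P >-> R}) (i : nat) (w : T) : R :=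
  (\sum_(k < i) X k w) / i%:R.

(* The supremum is taken in the extended reals: the sample means may be
   unbounded above at exceptional sample points. *)
Definition tail_sup d (T : measurableType d) (R : realType)
    (P : probability T R) (X : nat -> {RV P >-> R}) (n : nat) (w : T) : \bar R :=
  ereal_sup [set (sample_mean X i w)%:E | i in [set i | (n <= i)%N]].

(* [fine] sends an infinite supremum to 0, so this is sqrt n times the tail
   supremum wherever the latter is finite. *)
Definition scaled_tail_sup d (T : measurableType d) (R : realType)
    (P : probability T R) (X : nat -> {RV P >-> R}) (n : nat) (w : T) : R :=
  Num.sqrt n%:R * fine (tail_sup X n w).

Section measurability.
Context d (T : measurableType d) (R : realType) (P : probability T R).
Variable X : nat -> {RV P >-> R}.

Lemma measurable_sample_mean i : measurable_fun [set: T] (sample_mean X i).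
Proof.
apply: measurable_funM => //.
by apply: measurable_sum => k; exact: measurable_funPT.
Qed.

Lemma measurable_tail_sup n : measurable_fun [set: T] (tail_sup X n).
Proof.
apply: (@measurable_fun_esups _ _ _ _ (fun i w => (sample_mean X i w)%:E)).
by move=> i; apply/measurable_EFinP; exact: measurable_sample_mean.
Qed.

Lemma measurable_scaled_tail_sup n :
  measurable_fun [set: T] (scaled_tail_sup X n).
Proof.
apply: measurable_funM => //.
by apply: (@measurableT_comp _ _ _ _ _ _ fine) => //; exact: measurable_tail_sup.
Qed.

HB.instance Definition _ n := isMeasurableFun.Build _ _ _ _
  (scaled_tail_sup X n) (measurable_scaled_tail_sup n).

End measurability.

(* Main.v *)
(* With W_n = S_n / sqrt n and c > 0, the event sqrt n M_n > c says that the walk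
   S crosses the line s = c i / sqrt n at some time i >= n.
   For a given S_n below that line, the walk relative to the line has small drift
   - c / sqrt n, and exp (2 c (S_i / sqrt n - c i / n)) is a martingale up to an
   error of order o(1/n) per step; stopping it at the first crossing before
   time K n gives the conditional crossing probability exp (2 c (W_n - c)), up
   to errors that vanish as n, and then K, tends to infinity.  Crossings after
   time K n have probability O(1/K), by the Hajek-Renyi inequality (the same
   stopping argument applied to S_i^2 / i^2).  By the central limit theorem the
   crossing probability converges to E[min(1, exp (2 c (Z - c)))], and completing
   the square turns it into 2 P(Z > c) = P(|Z| > c).
   The central limit theorem is again the stopping argument, without stopping,
   for the exact heat solution (t, y) |-> Phi (y / sqrt t). *)

From HB Require Import structures.
Require Import Defs.
From mathcomp Require Import all_boot all_order all_algebra finmap.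
From mathcomp Require Import all_classical all_reals all_analysis.
From mathcomp Require Import measurable_realfun.
From mathcomp Require Import ring lra.

Set Implicit Arguments.
Unset Strict Implicit.
Unset Printing Implicit Defensive.

Import Order.TTheory GRing.Theory Num.Theory.
Import numFieldNormedType.Exports.

Local Open Scope classical_set_scope.
Local Open Scope ring_scope.

(** * Independence of the next step from the past *)

(** The exponential in the overview need not be integrable, so it is cut at 1 ([barrier_exp]). A cut
    at the line itself would spoil the second-order expansion there. The discount exp (- th)
    prevents this: below the line the exponent is at most - th, and only a step that raises it by
    more than th meets the cut. In return, the value at a crossing is only known to lie between exp
    (- th) and 1, which yields two bounds that meet as th tends to 0. Taylor remainders are measured
    by [cub], which is cubic near 0 and quadratic far away; its rescaled mean is Lindeberg's term L
    n. One step costs O((1/n + L n)/n), hence K n steps cost O(K (1/n + L n)), which vanishes for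
    fixed K and th. So th and K are chosen before n. No stopping time and no conditional expectation
    is constructed: survival up to time i is an event of the past of i, and one further step is
    integrated out by Tonelli's theorem. Crossing estimates concern levels c > 0 only; the levels c
    <= 0 follow because tails are monotone and the limiting tail tends to 1 at 0. *)

Section independence.
Context d (T : measurableType d) (R : realType) (P : probability T R).
Variable X : nat -> {RV P >-> R}.

(** A pi-system generating the sigma-algebra of X_0, ..., X_(k-1). The sets [A i] with i >= k are
    irrelevant; a total family avoids dependent indexing. *)
Definition cylinder (k : nat) : set (set T) :=
  [set B | exists2 A : nat -> set R, (forall i, measurable (A i)) &
    B = \bigcap_(i in `I_k) (X i @^-1` A i)].

Lemma cylinder_measurable k : cylinder k `<=` measurable.
Proof.
move=> _ [A mA ->]; apply: bigcap_measurableType => i _.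
by rewrite -[X in measurable X]setTI; exact: measurable_funPT.
Qed.

Lemma setI_closed_cylinder k : setI_closed (cylinder k).
Proof.
move=> _ _ [A mA ->] [B mB ->]; exists (fun i => A i `&` B i).
  by move=> i; exact: measurableI.
apply/seteqP; split=> [w [wA wB] i ik|w wAB]; first by split; [exact: wA|exact: wB].
by split=> i /wAB[].
Qed.

Lemma cylinderT k : cylinder k setT.
Proof.
by exists (fun=> setT) => //; rewrite bigcapT.
Qed.

Lemma g_cylinder_measurable k : <<s cylinder k >> `<=` measurable.
Proof.
apply: smallest_sub; first exact: sigma_algebra_measurable.
exact: cylinder_measurable.
Qed.

Hypothesis Xindep : mutually_independent X.

Lemma cylinder_probability k (A : nat -> set R) : (forall i, measurable (A i)) ->
  P (\bigcap_(i in `I_k) (X i @^-1` A i)) =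
  (\prod_(i < k) P (X i @^-1` A i))%E.
Proof.
move=> mA.
pose J : {fset nat} := [fset i in iota 0 k]%fset.
have -> : `I_k = [set` J].
  by apply/seteqP; split=> i /=; rewrite !inE mem_iota.
rewrite Xindep//.
rewrite (perm_big (iota 0 k)) /=; first by rewrite -[X in iota 0 X]subn0 big_mkord.
apply: uniq_perm; [exact: fset_uniq|exact: iota_uniq|].
by move=> i; rewrite !inE.
Qed.

(** For fixed [A], both sides are finite measures in [E], namely a restriction of [P] and a multiple
    of [P]; they agree on the pi-system of cylinders, hence on the generated sigma-algebra. *)
Lemma past_indep k E A : <<s cylinder k >> E -> measurable A ->
  P (E `&` X k @^-1` A) = (P E * P (X k @^-1` A))%E.
Proof.
move=> cE mA.
have mXA : measurable (X k @^-1` A).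
  by rewrite -[X in measurable X]setTI; exact: measurable_funPT.
pose r := NngNum (fine_ge0 (measure_ge0 P (X k @^-1` A))).
rewrite muleC -[P (X k @^-1` A)]fineK ?fin_num_measure//.
apply: (@g_sigma_algebra_measure_unique _ _ _ (cylinder k)
  (@cylinder_measurable k) (fun=> setT) _ _ (mrestr P mXA) (mscale r P)) => //.
- by move=> _; exact: cylinderT.
- by rewrite bigcup_const.
- exact: setI_closed_cylinder.
- move=> _ [B mB ->].
  suff H : P ((\bigcap_(i in `I_k) X i @^-1` B i) `&` X k @^-1` A) =
    (P (X k @^-1` A) * P (\bigcap_(i in `I_k) X i @^-1` B i))%E.
    have fE : P (X k @^-1` A) = (fine (P (X k @^-1` A)))%:E.
      by rewrite fineK// fin_num_measure.
    exact: (etrans H (congr1 (fun x => x * _)%E fE)).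
  (* Putting [A] in coordinate k turns the intersection into a cylinder of length k+1, whose
     probability factors. *)
  pose C i := if i == k then A else B i.
  have mC i : measurable (C i) by rewrite /C; case: ifP.
  have -> : (\bigcap_(i in `I_k) X i @^-1` B i) `&` X k @^-1` A =
            \bigcap_(i in `I_k.+1) X i @^-1` C i.
    apply/seteqP; split=> w.
      move=> [wB wA] i /=; rewrite ltnS leq_eqVlt /C => /orP[/eqP ->|ik].
        by rewrite eqxx.
      by rewrite (ltn_eqF ik); exact: wB.
    move=> wC; split.
      move=> i /= ik; have /= := wC i (ltnW ik).
      by rewrite /C (ltn_eqF ik).
    by have /= := wC k (ltnSn k); rewrite /C eqxx.
  rewrite !cylinder_probability// big_ord_recr/= muleC /C eqxx.
  by congr (_ * _)%E; apply: eq_bigr => i _; rewrite (ltn_eqF (ltn_ord i)).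
- by move=> _; rewrite -ge0_fin_numE ?measure_ge0//; exact: fin_num_measure.
Qed.

Local Notation Past k := (g_sigma_algebraType (cylinder k)).

Lemma measurable_past k : measurable_fun [set: T] (id : T -> Past k).
Proof. by move=> _ A mA; rewrite setTI; exact: (g_cylinder_measurable mA). Qed.

Hypothesis Xident : identically_distributed X.

(** The joint law of the past and X_k is the product of the law of the past and the law of X_0, so
    Tonelli applies. This replaces conditioning on the past. *)
Lemma integral_past k (F : Past k * R -> \bar R) :
  measurable_fun [set: Past k * R] F -> (forall z, 0 <= F z)%E ->
  (\int[P]_w F (w, X k w) = \int[P]_w \int[P]_w' F (w, X 0%N w'))%E.
Proof.
move=> mF F0.
(* The whole past is one random element: the identity of [T], with the coarser sigma-algebra on its
   target. *)
pose idk : T -> Past k := id.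
have midk : isMeasurableFun _ _ _ _ idk by split; exact: measurable_past.
pose Y : {RV P >-> Past k} := HB.pack idk midk.
pose joint (w : T) : Past k * R := (Y w, X k w).
have mj : isMeasurableFun _ _ _ _ joint.
  by split; apply: measurable_fun_pair => //; exact: measurable_funPT.
pose J : {RV P >-> (Past k * R)%type} := HB.pack joint mj.
transitivity (\int[distribution P J]_z F z)%E.
  by rewrite ge0_integral_distribution.
transitivity (\int[(distribution P Y \x distribution P (X 0%N))%E]_z F z)%E.
  apply: eq_measure_integral => A mA _; apply/esym.
  apply: product_measure_unique => // B C mB mC.
  apply: (etrans _ (congr1 (fun x => P B * x)%E (Xident k 0%N mC))).
  by apply: (etrans _ (past_indep mB mC)); congr (P _); apply/seteqP; split.
rewrite fubini_tonelli1// /fubini_F ge0_integral_distribution//=.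
- apply: eq_integral => w _ /=.
  rewrite ge0_integral_distribution//=.
  apply: measurableT_comp => //.
- exact: measurable_fun_fubini_tonelli_F.
- by move=> w; apply: integral_ge0.
Qed.

End independence.

(** * Optional stopping for partial sums *)

Section stopped_sums.
Context d (T : measurableType d) (R : realType) (P : probability T R).
Variable X : nat -> {RV P >-> R}.
Local Notation Past k := (g_sigma_algebraType (cylinder X k)).

Definition psum (k : nat) (w : T) : R := \sum_(i < k) X i w.

Lemma psumS k w : psum k.+1 w = psum k w + X k w.
Proof. exact: big_ord_recr. Qed.

Lemma measurable_psum k : measurable_fun [set: T] (psum k).
Proof. by apply: measurable_sum => i; exact: measurable_funPT. Qed.

Lemma past_X k i : (i < k)%N -> measurable_fun [set: Past k] (X i : Past k -> R).
Proof.
move=> ik _ B mB; rewrite setTI; apply: sub_gen_smallest.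
exists (fun j => if j == i then B else setT).
  by move=> j; case: ifP.
apply/seteqP; split=> w /=.
  by move=> wB j /= jk; case: ifPn => [/eqP ->|].
by move=> /(_ i ik); rewrite eqxx.
Qed.

Lemma past_psum k i : (i <= k)%N ->
  measurable_fun [set: Past k] (psum i : Past k -> R).
Proof.
move=> ik; apply: measurable_sum => j; apply: past_X.
exact: leq_trans ik.
Qed.

Variables (n : nat) (D : nat -> set R).
Hypothesis mD : forall i, measurable (D i).

Definition survive (i : nat) : set T :=
  [set w | forall j, (n <= j <= i)%N -> D j (psum j w)].

Lemma survive_past i : <<s cylinder X i >> (survive i).
Proof.
rewrite (_ : survive i =
    \bigcap_(j in [set j | (n <= j <= i)%N]) psum j @^-1` D j); last first.
  by apply/seteqP; split=> w h j; exact: h.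
change (@measurable _ (Past i) (\bigcap_(j in [set j | (n <= j <= i)%N]) psum j @^-1` D j)).
apply: bigcap_measurableType => j /andP[_ ji].
by rewrite -[X in measurable X]setTI; exact: (past_psum ji).
Qed.

Lemma measurable_survive i : measurable (survive i).
Proof. exact: g_cylinder_measurable (@survive_past i). Qed.

Lemma surviveS i : (n <= i)%N ->
  survive i.+1 = survive i `&` psum i.+1 @^-1` D i.+1.
Proof.
move=> ni; apply/seteqP; split=> w /=.
  move=> h; split; last by apply: h; rewrite leqnn leqW.
  by move=> j /andP[nj ji]; apply: h; rewrite nj leqW.
move=> [h1 h2] j /andP[nj]; rewrite leq_eqVlt => /orP[/eqP ->//|ji].
by apply: h1; rewrite nj -ltnS.
Qed.

Lemma survive_refl : survive n = psum n @^-1` D n.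
Proof.
apply/seteqP; split=> w /=; first by apply; rewrite leqnn.
by move=> h j /andP[nj jn]; rewrite (_ : j = n)//; apply/eqP; rewrite eqn_leq jn.
Qed.

Hypothesis Xindep : mutually_independent X.
Hypothesis Xident : identically_distributed X.

(** The one-step Markov property: on an event of the past, the k-th step may be replaced by an
    independent copy of X_0 with the current position frozen. *)
Lemma integral_step k (E : set T) (phi : R -> R) : <<s cylinder X k >> E ->
  measurable_fun [set: R] phi -> (forall s, 0 <= phi s) ->
  (\int[P]_(w in E) (phi (psum k.+1 w))%:E =
   \int[P]_(w in E) \int[P]_w' (phi (psum k w + X 0%N w'))%:E)%E.
Proof.
move=> cE mphi phi0.
pose F (z : Past k * R) : \bar R := (\1_E (z.1 : T) * phi (psum k z.1 + z.2))%:E.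
have mF : measurable_fun [set: Past k * R] F.
  apply/measurable_EFinP; apply: measurable_funM.
    by apply: (measurableT_comp _ measurable_fst); exact: measurable_indic.
  apply: (measurableT_comp mphi); apply: measurable_funD => //.
  by apply: (measurableT_comp _ measurable_fst); exact: past_psum.
rewrite integral_mkcond [RHS]integral_mkcond.
transitivity (\int[P]_w F (w, X k w))%E.
  apply: eq_integral => w _; rewrite /F patchE/= indicE psumS.
  by case: ifP; rewrite ?mul1r ?mul0r.
rewrite integral_past//; last by move=> z; rewrite lee_fin mulr_ge0.
apply: eq_integral => w _; rewrite /F patchE/= indicE.
case: ifP => _.
  by apply: eq_integral => ? _; rewrite mul1r.
by rewrite integral0_eq// => ? _; rewrite mul0r.
Qed.

Section upper_lower.
Variables (phi : nat -> R -> R) (e : nat -> R) (a : R).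
Hypothesis mphi : forall i, measurable_fun [set: R] (phi i).
Hypothesis phi0 : forall i s, 0 <= phi i s.
Hypothesis e0 : forall i, 0 <= e i.
Hypothesis a0 : 0 <= a.

Local Notation A i := (\int[P]_(w in survive i) (phi i (psum i w))%:E)%E.

Let mphiS i E : measurable E ->
  measurable_fun E (fun w => (phi i (psum i w))%:E).
Proof.
move=> mE; apply/measurable_EFinP; apply: measurable_funTS.
by apply: measurableT_comp => //; exact: measurable_psum.
Qed.

Let mTphiS i E : measurable E ->
  measurable_fun E (fun w => \int[P]_w' (phi i.+1 (psum i w + X 0%N w'))%:E)%E.
Proof.
move=> mE; apply: measurable_funTS.
pose G (z : T * T) : \bar R := (phi i.+1 (psum i z.1 + X 0%N z.2))%:E.
apply: (@measurable_fun_fubini_tonelli_F _ _ _ _ _ P G).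
  apply/measurable_EFinP; apply: (measurableT_comp (mphi i.+1)).
  apply: measurable_funD.
    by apply: (measurableT_comp _ measurable_fst); exact: measurable_psum.
  by apply: (measurableT_comp _ measurable_snd); exact: measurable_funPT.
by move=> z; rewrite lee_fin.
Qed.

Let integral_surviveS i : (n <= i)%N ->
  (\int[P]_(w in survive i) (phi i.+1 (psum i.+1 w))%:E = A i.+1 +
   \int[P]_(w in survive i `\` survive i.+1) (phi i.+1 (psum i.+1 w))%:E)%E.
Proof.
move=> ni.
have sub : survive i.+1 `<=` survive i by rewrite surviveS//; exact: subIsetl.
have mE := measurable_survive.
rewrite -{1}(setDUK sub) ge0_integral_setU//.
- exact: measurableD.
- by apply: mphiS; rewrite setDUK.
- by move=> w _; rewrite lee_fin.
- by rewrite disj_set2E setDIK.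
Qed.

Let probability_surviveCS i : (n <= i)%N ->
  (P (~` survive i.+1) = P (~` survive i) + P (survive i `\` survive i.+1))%E.
Proof.
move=> ni.
have sub : survive i.+1 `<=` survive i by rewrite surviveS//; exact: subIsetl.
have mE := measurable_survive.
rewrite -measureU//; [|exact: measurableC|exact: measurableD|].
- congr (P _); apply/seteqP; split=> w /=.
    by move=> h; have [wi|wi] := pselect (survive i w); [right|left].
  by move=> [h|[_ h]//] /sub.
- by apply/seteqP; split=> w // [/= h [h' _]].
Qed.

Let off_survive i w : (n <= i)%N -> (survive i `\` survive i.+1) w ->
  ~ D i.+1 (psum i.+1 w).
Proof. by move=> ni [h]; rewrite surviveS// => h' h2; apply: h'. Qed.

Let integral_survive_refl :
  (\int[P]_w (phi n (psum n w))%:E = A n +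
   \int[P]_(w in ~` survive n) (phi n (psum n w))%:E)%E.
Proof.
have mE := measurable_survive n.
rewrite -{1}(setUv (survive n)) ge0_integral_setU//.
- exact: measurableC.
- by apply: mphiS; rewrite setUv.
- by move=> w _; rewrite lee_fin.
- by rewrite disj_set2E setICr.
Qed.

Let integral_off_ge E i : measurable E ->
  (forall w, E w -> a <= phi i (psum i w)) ->
  (a%:E * P E <= \int[P]_(w in E) (phi i (psum i w))%:E)%E.
Proof.
move=> mE h; rewrite -integral_cst//; apply: ge0_le_integral => //.
  by apply: mphiS.
Qed.

Let integral_off_le E i : measurable E ->
  (forall w, E w -> phi i (psum i w) <= a) ->
  (\int[P]_(w in E) (phi i (psum i w))%:E <= a%:E * P E)%E.
Proof.
move=> mE h; rewrite -integral_cst//; apply: ge0_le_integral => //.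
- by move=> w _; rewrite lee_fin.
- exact: mphiS.
Qed.

Let integral_e_le i E : measurable E -> (\int[P]_(w in E) (e i)%:E <= (e i)%:E)%E.
Proof.
move=> mE; rewrite integral_cst// -[leRHS]mule1.
by apply: lee_wpmul2l; [rewrite lee_fin|exact: probability_le1].
Qed.

Let integral_step_le i : (n <= i)%N ->
  (forall s, D i s ->
    (\int[P]_w (phi i.+1 (s + X 0%N w))%:E <= (phi i s + e i)%:E)%E) ->
  (\int[P]_(w in survive i) (phi i.+1 (psum i.+1 w))%:E <= A i + (e i)%:E)%E.
Proof.
move=> ni h; have mE := measurable_survive i.
rewrite (integral_step (@survive_past i))//.
apply: (@le_trans _ _ (\int[P]_(w in survive i) ((phi i (psum i w))%:E + (e i)%:E))%E).
  apply: ge0_le_integral => //.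
  - by move=> w _; apply: integral_ge0 => ? _; rewrite lee_fin.
  - exact: mTphiS.
  - by apply: emeasurable_funD => //; exact: mphiS.
  - by move=> w wi; rewrite -EFinD; apply: h; apply: wi; rewrite ni leqnn.
rewrite ge0_integralD//; last 3 first.
- by move=> w _; rewrite lee_fin.
- exact: mphiS.
- by move=> w _; rewrite lee_fin.
rewrite leeD2l//; exact: integral_e_le.
Qed.

Let integral_step_ge i : (n <= i)%N ->
  (forall s, D i s ->
    ((phi i s)%:E <= \int[P]_w (phi i.+1 (s + X 0%N w))%:E + (e i)%:E)%E) ->
  (A i <= \int[P]_(w in survive i) (phi i.+1 (psum i.+1 w))%:E + (e i)%:E)%E.
Proof.
move=> ni h; have mE := measurable_survive i.
rewrite (integral_step (@survive_past i))//.
apply: (@le_trans _ _ (\int[P]_(w in survive i)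
    ((\int[P]_w' (phi i.+1 (psum i w + X 0%N w'))%:E) + (e i)%:E))%E).
  apply: ge0_le_integral => //.
  - by move=> w _; rewrite lee_fin.
  - exact: mphiS.
  - by apply: emeasurable_funD => //; exact: mTphiS.
  - by move=> w wi; apply: h; apply: wi; rewrite ni leqnn.
rewrite ge0_integralD//; last 3 first.
- by move=> w _; apply: integral_ge0 => ? _; rewrite lee_fin.
- exact: mTphiS.
- by move=> w _; rewrite lee_fin.
rewrite leeD2l//; exact: integral_e_le.
Qed.

(** The left side bounds from below the mean of [phi] along the walk stopped on leaving [D]:
    survivors contribute their value at time N, and each exit contributes at least [a]. In the
    induction, the mass of [survive N] splits into [survive N.+1] and the exits at time N+1. *)
Lemma stopped_upper N : (n <= N)%N ->
  (forall i s, (n <= i < N)%N -> D i s ->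
    (\int[P]_w (phi i.+1 (s + X 0%N w))%:E <= (phi i s + e i)%:E)%E) ->
  (forall i s, (n <= i)%N -> ~ D i s -> a <= phi i s) ->
  (A N + a%:E * P (~` survive N) <=
   \int[P]_w (phi n (psum n w))%:E + (\sum_(n <= i < N) e i)%:E)%E.
Proof.
move=> nN hstep hoff; have mE := measurable_survive.
have base : (A n + a%:E * P (~` survive n) <= \int[P]_w (phi n (psum n w))%:E)%E.
  rewrite integral_survive_refl leeD2l// integral_off_ge//.
    exact: measurableC.
  by move=> w; rewrite survive_refl /= => h; exact: hoff.
elim: N nN hstep => [|N IH].
  rewrite leqn0 => /eqP n0 _; rewrite big_geq ?n0// adde0 -n0.
  exact: base.
rewrite leq_eqVlt => /orP[/eqP <- _|]; first by rewrite big_geq// adde0; exact: base.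
rewrite ltnS => nN hstep; rewrite big_nat_recr//= EFinD addeA.
apply: (@le_trans _ _ (A N + a%:E * P (~` survive N) + (e N)%:E)%E); last first.
  by rewrite leeD2r// IH// => i s /andP[ni iN]; apply: hstep; rewrite ni leqW.
rewrite probability_surviveCS// ge0_muleDr//.
apply: (@le_trans _ _ (\int[P]_(w in survive N) (phi N.+1 (psum N.+1 w))%:E +
    a%:E * P (~` survive N))%E).
  rewrite integral_surviveS// -addeA leeD2l// [leLHS]addeC leeD2r//.
  apply: integral_off_ge; first exact: measurableD.
  by move=> w /off_survive h; apply: hoff; [exact: leqW|exact: h].
by rewrite addeAC leeD2r//; apply: integral_step_le => // s; apply: hstep; rewrite nN /=.
Qed.
(** The mirror image for approximate submartingales: exits now contribute at most [a]. *)
Lemma stopped_lower N : (n <= N)%N ->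
  (forall i s, (n <= i < N)%N -> D i s ->
    ((phi i s)%:E <= \int[P]_w (phi i.+1 (s + X 0%N w))%:E + (e i)%:E)%E) ->
  (forall i s, (n <= i)%N -> ~ D i s -> phi i s <= a) ->
  (\int[P]_w (phi n (psum n w))%:E <=
   A N + a%:E * P (~` survive N) + (\sum_(n <= i < N) e i)%:E)%E.
Proof.
move=> nN hstep hoff; have mE := measurable_survive.
have base : (\int[P]_w (phi n (psum n w))%:E <= A n + a%:E * P (~` survive n))%E.
  rewrite integral_survive_refl leeD2l// integral_off_le//.
    exact: measurableC.
  by move=> w; rewrite survive_refl /= => h; exact: hoff.
elim: N nN hstep => [|N IH].
  rewrite leqn0 => /eqP n0 _; rewrite big_geq ?n0// adde0 -n0.
  exact: base.
rewrite leq_eqVlt => /orP[/eqP <- _|]; first by rewrite big_geq// adde0; exact: base.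
rewrite ltnS => nN hstep; rewrite big_nat_recr//= EFinD (addeC (_%:E) (e N)%:E) addeA.
have IHN i s : (n <= i < N)%N -> D i s ->
    ((phi i s)%:E <= \int[P]_w (phi i.+1 (s + X 0%N w))%:E + (e i)%:E)%E.
  by move=> /andP[ni iN]; apply: hstep; rewrite ni leqW.
apply: (le_trans (IH nN IHN)); rewrite leeD2r//.
apply: (@le_trans _ _ (\int[P]_(w in survive N) (phi N.+1 (psum N.+1 w))%:E +
    (e N)%:E + a%:E * P (~` survive N))%E).
  by rewrite leeD2r//; apply: integral_step_ge => // s; apply: hstep; rewrite nN /=.
rewrite probability_surviveCS// ge0_muleDr//.
rewrite addeAC leeD2r// integral_surviveS// -addeA leeD2l// [leLHS]addeC leeD2l//.
apply: integral_off_le; first exact: measurableD.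
by move=> w /off_survive h; apply: hoff; [exact: leqW|exact: h].
Qed.
End upper_lower.
End stopped_sums.

(** * Second-order expansions and Lindeberg's term *)

Section truncated_cube.
Context {R : realType}.
Implicit Types x z k : R.

(** The quadratic branch keeps this integrable for a square integrable variable; the cubic branch
    makes it small under the scaling by sqrt n. *)
Definition cub z : R := Num.min (z ^+ 2) (`|z| ^+ 3).

Lemma cub_ge0 z : 0 <= cub z.
Proof. by rewrite le_min sqr_ge0 exprn_ge0. Qed.

Lemma cub_le_sqr z : cub z <= z ^+ 2.
Proof. by rewrite ge_min lexx. Qed.

Lemma cub_le_cube z : cub z <= `|z| ^+ 3.
Proof. by rewrite ge_min lexx orbT. Qed.

Lemma measurable_cub : measurable_fun [set: R] cub.
Proof.
apply: measurable_minr; first exact: measurable_funX.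
by apply: measurable_funX; exact: normr_measurable.
Qed.

Lemma cubZ k z : 0 <= k -> cub (k * z) <= (k ^+ 2 + k ^+ 3) * cub z.
Proof.
move=> k0; rewrite /cub normrM (ger0_norm k0) !exprMn.
have [_|_] := leP (z ^+ 2) (`|z| ^+ 3).
  rewrite ge_min; apply/orP; left.
  by rewrite ler_wpM2r ?sqr_ge0// lerDl exprn_ge0.
rewrite ge_min; apply/orP; right.
by rewrite ler_wpM2r ?exprn_ge0// lerDr sqr_ge0.
Qed.

End truncated_cube.

Section second_order_integrals.
Context d (T : measurableType d) (R : realType) (P : probability T R).
Variable Y : {RV P >-> R}.
Hypothesis EY : (\int[P]_w (Y w)%:E = 0)%E.
Hypothesis EY2 : (\int[P]_w (Y w ^+ 2)%:E = 1)%E.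

Let mY : measurable_fun [set: T] Y. Proof. exact: measurable_funPT. Qed.

Let integrable_sqr : P.-integrable [set: T] (fun w => (Y w ^+ 2)%:E).
Proof.
apply/integrableP; split; first by apply/measurable_EFinP; exact: measurable_funX.
under eq_integral do rewrite abse_EFin ger0_norm ?sqr_ge0//.
by rewrite EY2 ltry.
Qed.

Let integrableD_EFin (f g : T -> R) :
  P.-integrable setT (EFin \o f) -> P.-integrable setT (EFin \o g) ->
  P.-integrable setT (EFin \o (fun w => f w + g w)).
Proof. by move=> fi gi; exact: (integrableD _ fi gi). Qed.

Let integrableZ_EFin (k : R) (f : T -> R) :
  P.-integrable setT (EFin \o f) ->
  P.-integrable setT (EFin \o (fun w => k * f w)).
Proof. by move=> fi; exact: (integrableZl _ _ fi). Qed.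

Let integrable_cst (k : R) : P.-integrable setT (EFin \o cst k).
Proof. exact: finite_measure_integrable_cst. Qed.

Let integrable_Y : P.-integrable [set: T] (EFin \o Y).
Proof.
apply: (@le_integrable _ _ _ _ _ _ _ (fun w => (1 + Y w ^+ 2)%:E)) => //.
- exact/measurable_EFinP.
- move=> w _ /=; rewrite lee_fin [leRHS]ger0_norm ?addr_ge0 ?sqr_ge0//.
  have := sqr_ge0 (`|Y w| - 1); rewrite sqrrB real_normK ?num_real// => h.
  by have := normr_ge0 (Y w); lra.
- exact: integrableD_EFin (integrable_cst 1) integrable_sqr.
Qed.

(* Lindeberg's term: E[min(Y^2, |Y|^3 / sqrt n)]. *)
Definition lindeberg (n : nat) : R :=
  fine (\int[P]_w (n%:R * cub (Y w / Num.sqrt n%:R))%:E)%E.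

Let lind_fun n w := n%:R * cub (Y w / Num.sqrt n%:R) : R.

Let lind_fun_le n w : 0 <= lind_fun n w <= Y w ^+ 2.
Proof.
rewrite /lind_fun mulr_ge0 ?cub_ge0//=; have [->|n0] := posnP n.
  by rewrite mul0r sqr_ge0.
apply: le_trans (ler_wpM2l _ (cub_le_sqr _)) _ => //.
by rewrite expr_div_n sqr_sqrtr// mulrCA divff ?mulr1// pnatr_eq0 -lt0n.
Qed.

Let measurable_lind_fun n : measurable_fun [set: T] (lind_fun n).
Proof.
apply: measurable_funM => //.
apply: (measurableT_comp measurable_cub); exact: measurable_funM.
Qed.

Let integrable_lind n : P.-integrable [set: T] (EFin \o lind_fun n).
Proof.
apply: (le_integrable _ _ _ integrable_sqr) => //.
  exact/measurable_EFinP.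
move=> w _ /=; have /andP[l0 l1] := lind_fun_le n w.
by rewrite lee_fin ger0_norm// ger0_norm ?sqr_ge0.
Qed.

Lemma lindeberg_ge0 n : 0 <= lindeberg n.
Proof.
apply: fine_ge0; apply: integral_ge0 => w _.
by rewrite lee_fin; have /andP[] := lind_fun_le n w.
Qed.

Lemma lindebergE n : (\int[P]_w (lind_fun n w)%:E = (lindeberg n)%:E)%E.
Proof. by rewrite fineK//; exact: integrable_fin_num (integrable_lind n). Qed.

Let cvg_lind_fun w : lind_fun n w @[n --> \oo] --> 0.
Proof.
apply: (@squeeze_cvgr _ _ _ _ (fun=> 0) (fun n => `|Y w| ^+ 3 / Num.sqrt n%:R)).
- near=> n.
  have /andP[-> _] := lind_fun_le n w; rewrite /=.
  have n0 : (0 < n)%N by near: n; exact: nbhs_infty_gt.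
  apply: le_trans (ler_wpM2l _ (cub_le_cube _)) _ => //.
  have s0 : 0 < Num.sqrt n%:R :> R by rewrite sqrtr_gt0 ltr0n.
  rewrite normrM (gtr0_norm (_ : 0 < _^-1)) ?invr_gt0// exprMn.
  rewrite -{1}(@sqr_sqrtr _ n%:R)//.
  rewrite le_eqVlt; apply/orP; left; apply/eqP.
  by field; rewrite gt_eqF.
- exact: cvg_cst.
- rewrite -[X in _ --> X](mulr0 (`|Y w| ^+ 3)); apply: cvgM; first exact: cvg_cst.
  under eq_fun do rewrite -sqrtrV//.
  rewrite -(@sqrtr0 R).
  apply: (@cvg_comp _ _ _ (fun n : nat => n%:R^-1) Num.sqrt _ (nbhs 0)); last exact: sqrt_continuous.
  apply/gtr0_cvgV0; last exact: cvgr_idn.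
  by near=> n; rewrite ltr0n; near: n; exact: nbhs_infty_gt.
Unshelve. all: by end_near. Qed.

(** Dominated convergence: the integrand is at most Y^2, and pointwise at most |Y|^3 / sqrt n. *)
Lemma lindeberg_cvg0 : lindeberg n @[n --> \oo] --> 0.
Proof.
have [] := @dominated_convergence _ _ _ P setT measurableT
  (fun n w => (lind_fun n w)%:E) (cst 0%E) (fun w => (Y w ^+ 2)%:E).
- by move=> n; exact/measurable_EFinP.
- exact: measurable_cst.
- apply: aeW => w _; apply: cvg_EFin; last exact: cvg_lind_fun.
  by near=> n.
- exact: integrable_sqr.
- apply: aeW => w n _; have /andP[l0 l1] := lind_fun_le n w.
  by rewrite lee_fin ger0_norm.
move=> _ _; rewrite integral0 => /fine_cvgP[_].
by [].
Unshelve. all: by end_near. Qed.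

Let quad n (a b c k : R) w := a + b * Y w + c * Y w ^+ 2 + k * lind_fun n w.

Let integrable_quad n a b c k : P.-integrable [set: T] (EFin \o quad n a b c k).
Proof.
do !apply: integrableD_EFin; [exact: integrable_cst| | |]; exact: integrableZ_EFin.
Qed.

Let integral_quad n a b c k :
  (\int[P]_w (quad n a b c k w)%:E = (a + c + k * lindeberg n)%:E)%E.
Proof.
have i1 := integrableZ_EFin b integrable_Y.
have i2 := integrableZ_EFin c integrable_sqr.
have i3 := integrableZ_EFin k (integrable_lind n).
have i01 := integrableD_EFin (integrable_cst a) i1.
have i012 := integrableD_EFin i01 i2.
rewrite (integralD_EFin _ i012 i3)// (integralD_EFin _ i01 i2)//.
rewrite (integralD_EFin _ (integrable_cst a) i1)//.
have -> : (\int[P]_x (EFin \o cst a) x = a%:E)%E.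
  by have := expectation_cst P a; rewrite unlock.
have -> : (\int[P]_x (EFin \o (fun w => b * Y w)%R) x = 0)%E.
  by rewrite (integralZl _ integrable_Y)//= EY mule0.
have -> : (\int[P]_x (EFin \o (fun w => c * Y w ^+ 2)%R) x = c%:E)%E.
  by rewrite (integralZl _ integrable_sqr)//= EY2 mule1.
have -> : (\int[P]_x (EFin \o (fun w => k * lind_fun n w)%R) x =
    k%:E * (lindeberg n)%:E)%E.
  by rewrite (integralZl _ (integrable_lind n))//= lindebergE.
by rewrite adde0 -EFinM -!EFinD.
Qed.

(** Turns a pointwise second-order expansion in the step into a bound on its mean: the linear term
    has mean 0, the square has mean 1, and the remainder becomes Lindeberg's term. *)
Lemma integral_le_quadratic n (f : R -> R) (a b c k : R) :
  measurable_fun [set: R] f -> (forall x, 0 <= f x) ->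
  (forall x, f x <= a + b * x + c * x ^+ 2 +
     k * (n%:R * cub (x / Num.sqrt n%:R))) ->
  (\int[P]_w (f (Y w))%:E <= (a + c + k * lindeberg n)%:E)%E.
Proof.
move=> mf f0 fle; rewrite -(integral_quad n a b c k).
apply: ge0_le_integral => //.
- by move=> w _; rewrite lee_fin.
- by apply/measurable_EFinP; exact: measurableT_comp.
- exact: measurable_int (integrable_quad n a b c k).
- by move=> w _; rewrite lee_fin; exact: fle.
Qed.

(** The minorant may be negative, so the comparison of integrals goes through integrability of [f];
    hence the bound by 1. *)
Lemma integral_ge_quadratic n (f : R -> R) (a b c k : R) :
  measurable_fun [set: R] f -> (forall x, 0 <= f x <= 1) ->
  (forall x, a + b * x + c * x ^+ 2 +
     k * (n%:R * cub (x / Num.sqrt n%:R)) <= f x) ->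
  ((a + c + k * lindeberg n)%:E <= \int[P]_w (f (Y w))%:E)%E.
Proof.
move=> mf f01 fle; rewrite -(integral_quad n a b c k).
apply: le_integral => //; first exact: integrable_quad.
  apply: (@le_integrable _ _ _ _ _ _ _ (EFin \o cst 1)) => //.
  - by apply/measurable_EFinP; exact: measurableT_comp.
  - move=> w _ /=; have /andP[f0 f1] := f01 (Y w).
    by rewrite lee_fin ger0_norm// normr1.
by move=> w _; rewrite lee_fin; exact: fle.
Qed.

Lemma integral_sqr_translate (s : R) :
  (\int[P]_w ((s + Y w) ^+ 2)%:E = (s ^+ 2 + 1)%:E)%E.
Proof.
have := integral_quad 0 (s ^+ 2) (2 * s) 1 0.
rewrite mul0r addr0 => <-; apply: eq_integral => w _; congr EFin.
by rewrite /quad; ring.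
Qed.

End second_order_integrals.

(** * Taylor bounds with truncated cubic remainder *)

Section taylor.
Context {R : realType}.
Implicit Types (f df : R -> R) (x y v : R).

Lemma MVT_normr f df (x v : R) : (forall y : R, is_derive y 1 f (df y)) ->
  exists2 s, `|s| <= `|v| & f (x + v) - f x = df (x + s) * v.
Proof.
move=> fdf.
have cf : continuous f.
  move=> y; apply: differentiable_continuous.
  by apply/derivable1_diffP; have [] := fdf y.
have [v0|v0] := leP 0 v.
  have [||c] := @MVT_segment _ f df x (x + v).
  - by rewrite lerDl.
  - exact: continuous_subspaceT.
  rewrite in_itv/= => /andP[xc cv] ->; exists (c - x).
    by rewrite !ger0_norm ?subr_ge0// lerBlDl.
  by rewrite addrCA subrr addr0 (addrC x v) addrK.
have [||c] := @MVT_segment _ f df (x + v) x.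
- by rewrite gerDl ltW.
- exact: continuous_subspaceT.
rewrite in_itv/= => /andP[xc cv] E; exists (c - x).
  by rewrite (ler0_norm (ltW v0)) ler0_norm ?subr_le0//; lra.
rewrite addrCA subrr addr0 -opprB E; ring.
Qed.

(** The mean value theorem is applied twice; this gives up the sharp factor 1/2, which is harmless
    here. *)
Lemma taylor1 (f f1 f2 : R -> R) (x v M : R) :
  (forall y : R, is_derive y 1 f (f1 y)) -> (forall y : R, is_derive y 1 f1 (f2 y)) ->
  (forall s, `|s| <= `|v| -> `|f2 (x + s)| <= M) ->
  `|f (x + v) - f x - f1 x * v| <= M * v ^+ 2.
Proof.
move=> d1 d2 M2; have [s sv ->] := MVT_normr x v d1.
rewrite -mulrBl; have [t ts ->] := MVT_normr x s d2.
rewrite !normrM -[v ^+ 2]real_normK ?num_real// expr2 mulrA ler_wpM2r//.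
apply: ler_pM => //; exact: M2 (le_trans ts sv).
Qed.

Lemma taylor2 (f f1 f2 f3 : R -> R) (x v M3 : R) :
  (forall y : R, is_derive y 1 f (f1 y)) -> (forall y : R, is_derive y 1 f1 (f2 y)) ->
  (forall y : R, is_derive y 1 f2 (f3 y)) ->
  (forall s, `|s| <= `|v| -> `|f3 (x + s)| <= M3) ->
  `|f (x + v) - f x - f1 x * v - f2 x * v ^+ 2 / 2| <= M3 * `|v| ^+ 3.
Proof.
move=> d1 d2 d3 M33.
(* The derivative of [g] is the first-order Taylor remainder of [f1] at [x], to which [taylor1]
   applies. *)
pose g : R -> R := f - (f1 x \*: id) - ((f2 x / 2) \*: (id - cst x) ^+ 2).
have dg y : is_derive y 1 g (f1 y - f1 x - f2 x * (y - x)).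
  rewrite /g; apply: is_derive_eq.
  rewrite !fctE /= /GRing.scale /= /cst; field => //.
have [s sv] := MVT_normr x v dg.
have -> : g (x + v) - g x = f (x + v) - f x - f1 x * v - f2 x * v ^+ 2 / 2.
  rewrite /g !fctE /= /GRing.scale /= /cst; field => //.
move=> ->; rewrite normrM (exprSr _ 2) mulrA ler_wpM2r//.
have -> : x + s - x = s by ring.
apply: (le_trans (taylor1 d2 d3 (M := M3) _)).
  by move=> t ts; apply: M33; exact: le_trans sv.
have M30 : 0 <= M3 by apply: le_trans (M33 0 _) => //; rewrite normr0.
rewrite ler_wpM2l// -[s ^+ 2]real_normK ?num_real//.
by rewrite lerXn2r ?nnegrE.
Qed.

(** Where [cub v] is the cube, this is [taylor2]. Where it is the square, [taylor1] and the crude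
    bound on the quadratic term cost M2 v^2 each. *)
Lemma taylor_cub (f f1 f2 f3 : R -> R) (x v M2 M3 : R) :
  (forall y : R, is_derive y 1 f (f1 y)) -> (forall y : R, is_derive y 1 f1 (f2 y)) ->
  (forall y : R, is_derive y 1 f2 (f3 y)) ->
  (forall s, `|s| <= `|v| -> `|f2 (x + s)| <= M2) ->
  (forall s, `|s| <= `|v| -> `|f3 (x + s)| <= M3) ->
  `|f (x + v) - f x - f1 x * v - f2 x * v ^+ 2 / 2| <=
    (2 * M2 + M3) * cub v.
Proof.
move=> d1 d2 d3 b2 b3.
have h1 := taylor1 d1 d2 b2.
have h2 := taylor2 d1 d2 d3 b3.
have M30 : 0 <= M3 by apply: le_trans (b3 0 _) => //; rewrite normr0.
have M20 : 0 <= M2 by apply: le_trans (b2 0 _) => //; rewrite normr0.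
rewrite /cub; have [_|_] := leP (v ^+ 2) (`|v| ^+ 3).
  apply: (@le_trans _ _ (2 * M2 * v ^+ 2)); last first.
    by rewrite ler_wpM2r ?sqr_ge0// lerDl.
  apply: le_trans (ler_normB _ _) _.
  have -> : 2 * M2 * v ^+ 2 = M2 * v ^+ 2 + M2 * v ^+ 2 by ring.
  rewrite lerD//.
  have := b2 0; rewrite addr0 normr0 => /(_ (normr_ge0 _)) b20.
  rewrite -mulrA normrM; apply: ler_pM => //.
  have v0 := sqr_ge0 v.
  by rewrite ger0_norm ?divr_ge0//; lra.
apply: (le_trans h2); rewrite ler_wpM2r// ?lerDr ?mulr_ge0//.
Qed.

End taylor.

(** * Gaussian calculus *)

Section gaussian.
Context {R : realType}.
Implicit Types x y m v r : R.

Local Notation mu := (@lebesgue_measure R).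

Definition gpdf x : R := normal_pdf 0 1 x.
Definition Phi x : R := fine (normal_prob 0 1 `]-oo, x]).

Lemma gpdfE x : gpdf x = normal_peak 1 * expR (- (x ^+ 2 / 2)).
Proof.
rewrite /gpdf normal_pdfE ?oner_neq0// /normal_fun subr0 expr1n.
by rewrite mulNr mulr2n.
Qed.

Lemma gpdfN x : gpdf (- x) = gpdf x.
Proof. by rewrite !gpdfE sqrrN. Qed.

Lemma gpdf_ge0 x : 0 <= gpdf x.
Proof. exact: normal_pdf_ge0. Qed.

Lemma gpdf_le_expR x : gpdf x <= expR (- (x ^+ 2 / 2)).
Proof.
have h : 1 <= Num.sqrt (1 ^+ 2 * pi *+ 2 : R).
  rewrite expr1n mul1r -{1}sqrtr1 ler_sqrt; have := pi_ge2 R; rewrite mulr2n; lra.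
by rewrite gpdfE ler_piMl ?expR_ge0// invf_le1// (lt_le_trans ltr01).
Qed.

(** This and the next bound are 1 + u <= exp u, at u = x^2/2 and, squared, at u = x^2/4. They make
    polynomial multiples of the density bounded up to degree 3. *)
Let gauss1 x : (1 + x ^+ 2 / 2) * expR (- (x ^+ 2 / 2)) <= 1.
Proof.
rewrite expRN ler_pdivrMr ?expR_gt0// mul1r; exact: expR_ge1Dx.
Qed.

Let gauss2 x : (1 + x ^+ 2 / 4) ^+ 2 * expR (- (x ^+ 2 / 2)) <= 1.
Proof.
rewrite expRN ler_pdivrMr ?expR_gt0// mul1r.
have -> : x ^+ 2 / 2 = 2%:R * (x ^+ 2 / 4) by field.
rewrite expRM_natl lerXn2r ?nnegrE ?expR_ge0//.
  by have := sqr_ge0 x; lra.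
exact: expR_ge1Dx.
Qed.

Lemma normr_gpdf1 x : `|x * gpdf x| <= 1.
Proof.
rewrite normrM (ger0_norm (gpdf_ge0 x)).
apply: le_trans (ler_wpM2l (normr_ge0 _) (gpdf_le_expR x)) _.
apply: le_trans _ (gauss1 x); rewrite ler_wpM2r ?expR_ge0//.
have := sqr_ge0 (`|x| - 1); rewrite sqrrB real_normK ?num_real//; lra.
Qed.

Lemma normr_gpdf2 x : `|(x ^+ 2 - 1) * gpdf x| <= 2.
Proof.
rewrite normrM (ger0_norm (gpdf_ge0 x)).
apply: le_trans (ler_wpM2l (normr_ge0 _) (gpdf_le_expR x)) _.
have h := gauss1 x.
apply: (@le_trans _ _ (2 * ((1 + x ^+ 2 / 2) * expR (- (x ^+ 2 / 2))))); last lra.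
rewrite mulrA ler_wpM2r ?expR_ge0//.
by have x0 := sqr_ge0 x; rewrite ler_norml; apply/andP; split; lra.
Qed.

Lemma normr_gpdf3 x : `|x| ^+ 3 * gpdf x <= 8.
Proof.
apply: le_trans (ler_wpM2l _ (gpdf_le_expR x)) _; first by rewrite exprn_ge0.
have h := gauss2 x.
apply: (@le_trans _ _ (8 * ((1 + x ^+ 2 / 4) ^+ 2 * expR (- (x ^+ 2 / 2))))); last lra.
rewrite mulrA ler_wpM2r ?expR_ge0//.
rewrite -[x ^+ 2]real_normK ?num_real//.
have := normr_ge0 x; move: `|x| => y y0.
have y1 := sqr_ge0 (y * (y - 1)); have y2 := sqr_ge0 y; lra.
Qed.

Lemma continuous_gpdf : continuous gpdf.
Proof. exact: continuous_normal_pdf. Qed.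

Lemma is_derive_gpdf x : is_derive x 1 gpdf (- (x * gpdf x)).
Proof.
have -> : gpdf = normal_peak 1 \*: (expR \o (- (2^-1 \*: (id ^+ 2)))).
  apply/funext => y; rewrite gpdfE !fctE /= /GRing.scale /=.
  by rewrite [2^-1 * _]mulrC.
apply: is_derive_eq.
rewrite /= /GRing.scale /=; field => //.
Qed.

Lemma is_derive_gpdf' x :
  is_derive x 1 (fun y => - (y * gpdf y)) ((x ^+ 2 - 1) * gpdf x).
Proof.
have -> : (fun y => - (y * gpdf y)) = - (id * gpdf) by [].
have h := is_derive_gpdf x.
apply: is_derive_eq.
rewrite /= /GRing.scale /=; field => //.
Qed.

Lemma is_derive_Phi x : is_derive x 1 Phi (gpdf x).
Proof.
have fi : mu.-integrable `]-oo, (x + 1)] (EFin \o gpdf).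
  by apply: (integrableS _ _ (subsetT _)) => //; exact: integrable_normal_pdf.
have [|dF <-] := continuous_FTC1 _ fi (ltNyr _) (@continuous_gpdf x).
  by rewrite ltrDl.
apply: DeriveDef; first exact: dF.
by rewrite derive1E.
Qed.

Lemma continuous_Phi : continuous Phi.
Proof.
move=> y; apply: differentiable_continuous.
by apply/derivable1_diffP; have [] := is_derive_Phi y.
Qed.

Lemma Phi_ge0 x : 0 <= Phi x. Proof. exact: fine_ge0. Qed.

Lemma EFin_Phi x : (Phi x)%:E = normal_prob 0 1 `]-oo, x].
Proof. by rewrite fineK// fin_num_measure. Qed.

Lemma Phi_le1 x : Phi x <= 1.
Proof. by rewrite -lee_fin EFin_Phi probability_le1. Qed.

Lemma measurable_Phi : measurable_fun [set: R] Phi.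
Proof. by apply: continuous_measurable_fun; exact: continuous_Phi. Qed.

Lemma le_Phi x y : x <= y -> Phi x <= Phi y.
Proof.
move=> xy; rewrite -lee_fin !EFin_Phi; apply: le_measure; rewrite ?inE//.
by apply: subset_itvl; rewrite bnd_simp.
Qed.

(** The constant is 2 * 1 + 2, from the bounds 1 and 2 on the second and third derivatives of
    [Phi]. *)
Lemma Phi_taylor m v :
  `|Phi (m + v) - Phi m - gpdf m * v + m * gpdf m * v ^+ 2 / 2| <= 4 * cub v.
Proof.
have := taylor_cub (x := m) (v := v) is_derive_Phi is_derive_gpdf is_derive_gpdf'
  (M2 := 1) (M3 := 2).
rewrite mulNr mulNr opprK (_ : 2 * 1 + 2 = 4); last by ring.
apply.
- by move=> s _; rewrite normrN normr_gpdf1.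
- by move=> s _; exact: normr_gpdf2.
Qed.

(** An expansion in the scale r at 1, uniform in m: the second derivative of u |-> Phi (m u) has
    absolute value |m u|^3 gpdf (m u) / u^2, at most 8 * 4 for u >= 1/2. *)
Lemma Phi_scale_taylor m r : 2^-1 <= r -> r <= 1 ->
  `|Phi (m * r) - Phi m - m * gpdf m * (r - 1)| <= 32 * (1 - r) ^+ 2.
Proof.
move=> r2 r1.
have d1 (y : R) : is_derive y 1 (fun u => Phi (m * u)) (m * gpdf (m * y)).
  have -> : (fun u => Phi (m * u)) = Phi \o (m \*: id) by [].
  have h := is_derive_Phi (m * y).
  apply: is_derive_eq.
  by rewrite /= /GRing.scale /= mulr1 mulrC.
have d2 (y : R) : is_derive y 1 (fun u => m * gpdf (m * u))
    (- (m ^+ 2 * (m * y * gpdf (m * y)))).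
  have -> : (fun u => m * gpdf (m * u)) = m \*: (gpdf \o (m \*: id)) by [].
  have h := is_derive_gpdf (m * y).
  apply: is_derive_eq.
  rewrite /= /GRing.scale /=; field => //.
have := taylor1 (x := 1) (v := r - 1) (M := 32) d1 d2.
rewrite addrCA subrr addr0 mulr1 -(sqrrN (r - 1)) opprB; apply => s.
rewrite (ler0_norm (_ : r - 1 <= 0)) ?subr_le0// opprB => sr.
have u2 : 2^-1 <= 1 + s by have := ler_norm (- s); rewrite normrN; lra.
have u0 : 0 < 1 + s by lra.
rewrite normrN; move: (1 + s) u0 u2 => u u0 u2.
have h := normr_gpdf3 (m * u).
have -> : `|m ^+ 2 * (m * u * gpdf (m * u))| =
    (`|m * u| ^+ 3 * gpdf (m * u)) * (u ^- 2).
  rewrite !normrM (ger0_norm (gpdf_ge0 _)) (ger0_norm (ltW u0)).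
  by field; rewrite gt_eqF.
have -> : 32 = 8 * 4 :> R by ring.
apply: ler_pM => //.
- by rewrite mulr_ge0 ?exprn_ge0 ?gpdf_ge0.
- by rewrite invr_ge0 sqr_ge0.
- rewrite -[leRHS]invrK lef_pV2 ?posrE ?invr_gt0 ?exprn_gt0//.
  have -> : 4^-1 = 2^-1 ^+ 2 :> R by field.
  by rewrite lerXn2r ?nnegrE ?(ltW u0).
Qed.

End gaussian.

(** * Integrals against the standard normal law *)

Section gaussian_integrals.
Context {R : realType}.
Implicit Types x y c : R.

Local Notation mu := (@lebesgue_measure R).
Local Notation N01 := (normal_prob (0 : R) 1).

Lemma normal_prob_gt x : N01 `]x, +oo[ = (1 - Phi x)%:E.
Proof.
rewrite -setCitvl probability_setC// EFinB; congr (_ - _)%E.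
by rewrite EFin_Phi.
Qed.

Lemma PhiN x : Phi (- x) = 1 - Phi x.
Proof.
apply: EFin_inj; rewrite -normal_prob_gt EFin_Phi /normal_prob.
rewrite ge0_integration_by_substitutionNy; last 2 first.
- by apply: continuous_subspaceT; exact: continuous_gpdf.
- by move=> y _; exact: gpdf_ge0.
transitivity (\int[mu]_(y in `[x, +oo[) (gpdf y)%:E)%E.
  by apply: eq_integral => y _ /=; congr EFin; exact: gpdfN.
apply/esym/integral_itv_obnd_cbnd.
by apply: measurable_funTS; apply/measurable_EFinP; exact: measurable_normal_pdf.
Qed.

Lemma cvg_Phiy : Phi x @[x --> +oo] --> (1 : R).
Proof.
have mid : isMeasurableFun _ _ _ _ (idfun : measurableTypeR R -> R).
  by split; exact: measurable_id.
pose I : {RV N01 >-> R} := HB.pack (idfun : measurableTypeR R -> R) mid.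
by have := cvg_cdfy1 I => /fine_cvgP[_].
Qed.

Lemma Phi_near1 (e : R) : 0 < e -> exists2 x, 0 < x & 1 - Phi x < e.
Proof.
move=> e0; have : \forall x \near +oo, (0 < x) && (1 - e < Phi x).
  near=> x; apply/andP; split; first by near: x; exact: nbhs_pinfty_gt.
  by near: x; apply: (cvgr_gt 1); [exact: cvg_Phiy|rewrite gtrBl].
move=> /filter_ex[x /andP[x0 h]]; exists x => //; lra.
Unshelve. all: by end_near. Qed.

(** The change of variables goes through the Radon-Nikodym derivative of the normal law, which
    equals [gpdf] almost everywhere because both have the same integrals over measurable sets. *)
Lemma integral_normal_prob (U : set R) (f : R -> R) : measurable U ->
  measurable_fun [set: R] f -> (forall x, U x -> 0 <= f x <= 1) ->
  (\int[N01]_(x in U) (f x)%:E = \int[mu]_(x in U) (f x * gpdf x)%:E)%E.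
Proof.
move=> mU mf f01.
have dom : N01 `<< mu := normal_prob_dominates 0 1.
rewrite -(Radon_Nikodym_change_of_variables dom)//=; last first.
  apply/integrableP; split; first exact/measurable_funTS/measurable_EFinP.
  apply: (@le_lt_trans _ _ (\int[N01]_(x in U) 1)%E).
    apply: ge0_le_integral => //.
    - by apply: measurableT_comp => //; exact/measurable_funTS/measurable_EFinP.
    - move=> x Ux /=; have /andP[f0 f1] := f01 x Ux.
      by rewrite lee_fin ger0_norm.
  rewrite integral_cst// mul1e.
  by rewrite -ge0_fin_numE ?fin_num_measure.
under [RHS]eq_integral do rewrite EFinM.
have mg : measurable_fun [set: R] (EFin \o gpdf).
  by apply/measurable_EFinP; exact: measurable_normal_pdf.
apply: ae_eq_integral => //.
- apply: emeasurable_funM; first exact/measurable_funTS/measurable_EFinP.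
  apply: (measurable_int mu).
  apply: (integrableS _ _ (@subsetT _ _)) => //=.
  exact: Radon_Nikodym_integrable.
- by apply: emeasurable_funM; apply: measurable_funTS => //; exact/measurable_EFinP.
- apply: ae_eqe_mul2l => /=.
  rewrite Radon_NikodymE//=.
  case: cid => /= h [h1 h2 h3].
  apply: integral_ae_eq => //=.
  + exact: integrableS h2.
  + exact: measurable_funTS.
  + by move=> E E01 mE; rewrite -h3.
Qed.

(* The probability that Brownian motion with drift - c started at y - c ever
   reaches [0, +oo[. *)
Definition hit c y : R := Num.min 1 (expR (2 * c * (y - c))).

(** Each side of [c] contributes 1 - Phi c. Above [c] the integrand is 1. Below, exp (2 c (y - c))
    gpdf y = gpdf (y - 2 c), whose integral over y <= c is Phi (- c). *)
Lemma integral_hit c : 0 < c -> (\int[N01]_y (hit c y)%:E = (2 * (1 - Phi c))%:E)%E.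
Proof.
move=> c0.
have mexp : measurable_fun [set: R] (fun y => expR (2 * c * (y - c))).
  apply: measurableT_comp => //; apply: measurable_funM => //.
  exact: measurable_funB.
have mh : measurable_fun [set: R] (hit c) by exact: measurable_minr.
have -> : [set: R] = `]-oo, c] `|` `]c, +oo[.
  by rewrite -setCitvl setUv.
rewrite ge0_integral_setU//; last 3 first.
- by rewrite -setCitvl setUv; exact/measurable_EFinP.
- by move=> y _; rewrite lee_fin le_min ler01 expR_ge0.
- by rewrite -setCitvl; apply/disj_setPCl.
rewrite mulrDl mul1r EFinD; congr (_ + _)%E; last first.
  rewrite (eq_integral (cst 1%E)); last first.
    move=> y; rewrite inE/= in_itv/= andbT => cy; congr EFin.
    apply/min_idPl; rewrite -expR0 ler_expR mulr_ge0 ?mulr_ge0 ?subr_ge0// ltW//.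
  by rewrite integral_cst// mul1e; exact: normal_prob_gt.
transitivity (\int[N01]_(y in `]-oo, c]) (expR (2 * c * (y - c)))%:E)%E.
  apply: eq_integral => y; rewrite inE/= in_itv/= => yc; congr EFin.
  apply/min_idPr; rewrite -expR0 ler_expR mulr_ge0_le0 ?mulr_ge0 ?subr_le0// ltW//.
rewrite integral_normal_prob//; last first.
  move=> y; rewrite /= in_itv/= => yc.
  rewrite expR_ge0/= -expR0 ler_expR mulr_ge0_le0 ?mulr_ge0 ?subr_le0// ltW//.
(* The translation y |-> y - 2 c, which sends the endpoint c to - c. *)
pose F : R -> R := shift (- (2 * c)).
have F'E : F^`()%classic = cst 1.
  apply/funext => y; rewrite derive1E; apply: derive_val; exact: is_derive_shift.
have dF (y : R) : derivable F y 1 by have [] := @is_derive_shift R y 1 (- (2 * c)).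
have cF : continuous F by move=> y; apply: differentiable_continuous; apply/derivable1_diffP.
have := @increasing_ge0_integration_by_substitutionNy R F gpdf c.
rewrite F'E (_ : F c = - c); last by rewrite /F /=; ring.
move=> E; rewrite -PhiN EFin_Phi /normal_prob.
apply/esym; apply: (etrans (E _ _ _ _ _ _ _ _)).
- by move=> x y _ _ xy; rewrite /F /= ltrD2r.
- by move=> y _; exact: cvg_cst.
- exact: is_cvg_cst.
- exact: cvg_cst.
- by split => [y _|]; [exact: dF|apply: cvg_at_left_filter; exact: cF].
- exact: cvg_addrr_Ny.
- by apply: continuous_subspaceT; exact: continuous_gpdf.
- by move=> y _; exact: gpdf_ge0.
apply: eq_integral => y _; congr EFin.
rewrite /= mulr1 !gpdfE mulrCA -expRD /F /= gpdfE; congr (_ * expR _).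
by field.
Qed.

End gaussian_integrals.

(** * Central limit theorem *)

Section clt.
Context d (T : measurableType d) (R : realType) (P : probability T R).
Variable X : nat -> {RV P >-> R}.
Hypothesis Xindep : mutually_independent X.
Hypothesis Xident : identically_distributed X.
Hypothesis EX : (\int[P]_w (X 0%N w)%:E = 0)%E.
Hypothesis EX2 : (\int[P]_w (X 0%N w ^+ 2)%:E = 1)%E.

Local Notation L := (lindeberg (X 0%N)).

(** The heat equation over one time step: with m = y / sqrt t, adding relative time h replaces m by
    m r where r = 1 / sqrt (1 + h), and the change is the space term - m gpdf m h / 2 to first
    order. The constant is 32 from [Phi_scale_taylor] plus 1 from replacing 1 - r by h / 2. *)
Lemma heat_scaling (m h r : R) : 0 <= h -> h <= 1 -> 0 <= r ->
  r ^+ 2 * (1 + h) = 1 ->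
  `|Phi m - m * gpdf m * h / 2 - Phi (m * r)| <= 33 * h ^+ 2.
Proof.
move=> h0 h1 r0 rh.
have r1 : r <= 1.
  rewrite leNgt; apply/negP => r1.
  suff : 1 < r ^+ 2 * (1 + h) by rewrite rh ltxx.
  nra.
have r2h : r ^+ 2 * h = 1 - r ^+ 2 by lra.
(* Factor 1 - r^2 = r^2 h. *)
have rE : 1 - r = r ^+ 2 * h / (1 + r) by rewrite r2h; field; lra.
have r_le : 1 - r <= h / 2.
  rewrite rE -subr_ge0.
  have -> : h / 2 - r ^+ 2 * h / (1 + r) =
      h * (1 - r) * (1 + 2 * r) / (2 * (1 + r)) by field; lra.
  apply: divr_ge0; last lra.
  by apply: mulr_ge0; [apply: mulr_ge0; lra|lra].
have r_ge : 0 <= h / 2 - (1 - r) <= h ^+ 2.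
  have E : h / 2 - (1 - r) = (h * (1 - r) * (1 + 2 * r)) / (2 * (1 + r)).
    by rewrite {1}rE; field; lra.
  apply/andP; split; first by rewrite subr_ge0.
  rewrite E ler_pdivrMr; last lra.
  have : h * (1 - r) * (1 + 2 * r) <= h * (h / 2) * (2 * (1 + r)).
    by apply: ler_pM; [nra|lra|nra|lra].
  nra.
have r2 : 2^-1 <= r by lra.
have := Phi_scale_taylor m r2 r1; have := normr_gpdf1 m.
move: (m * gpdf m) => g gm H.
have -> : Phi m - g * h / 2 - Phi (m * r) =
  - (Phi (m * r) - Phi m - g * (r - 1)) - g * (h / 2 - (1 - r)).
  by ring.
apply: le_trans (ler_normB _ _) _; rewrite normrN.
have -> : 33 * h ^+ 2 = 32 * h ^+ 2 + 1 * h ^+ 2 :> R by ring.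
apply: lerD.
  apply: le_trans H _; rewrite ler_wpM2l//.
  by rewrite lerXn2r ?nnegrE; lra.
rewrite normrM; apply: ler_pM => //.
by case/andP: r_ge => r3 r4; rewrite ger0_norm.
Qed.

(** Trades Gaussian variance 1/n for one step X_0 / sqrt n. Integrating [Phi_taylor] over the step
    leaves the space term of [heat_scaling], with h = 1 / (n t). Staying at times t >= t0 makes the
    error uniform, and 1/n <= t0 ensures h <= 1. *)
Lemma clt_step (n : nat) (t t0 s a : R) : (0 < n)%N -> 0 < t0 -> t0 <= t ->
  n%:R^-1 <= t0 ->
  let e := (33 * t0 ^- 2 / n%:R +
    4 * ((Num.sqrt t0)^-1 ^+ 2 + (Num.sqrt t0)^-1 ^+ 3) * L n) / n%:R in
  let F := Phi ((s / Num.sqrt n%:R - a) / Num.sqrt (t + n%:R^-1)) in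
  let J := (\int[P]_w
    (Phi (((s + X 0%N w) / Num.sqrt n%:R - a) / Num.sqrt t))%:E)%E in
  (J <= (F + e)%:E)%E /\ (F%:E <= J + e%:E)%E.
Proof.
move=> n0 t00 t0t nt e F J.
have t_gt0 : 0 < t by lra.
have nR0 : 0 < n%:R :> R by rewrite ltr0n.
have sn0 : 0 < Num.sqrt n%:R :> R by rewrite sqrtr_gt0.
have st0 : 0 < Num.sqrt t by rewrite sqrtr_gt0.
have st00 : 0 < Num.sqrt t0 by rewrite sqrtr_gt0.
pose q := (Num.sqrt t)^-1; pose q0 := (Num.sqrt t0)^-1.
have q_gt0 : 0 < q by rewrite invr_gt0.
have qq0 : q <= q0 by rewrite lef_pV2 ?posrE// ler_sqrt// ltW.
have q2 : q ^+ 2 = t^-1 by rewrite /q exprVn sqr_sqrtr// ltW.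
pose m := (s / Num.sqrt n%:R - a) / Num.sqrt t.
pose h := (n%:R * t)^-1.
have h0 : 0 <= h by rewrite invr_ge0 mulr_ge0 ?ltW.
have ht0 : h <= t0^-1 / n%:R.
  rewrite /h invfM mulrC ler_wpM2r ?invr_ge0 ?(ltW nR0)// lef_pV2 ?posrE//.
have h1 : h <= 1.
  apply: (le_trans ht0); rewrite mulrC ler_pdivrMr// mul1r//.
pose r := Num.sqrt (1 + h)^-1.
have r2 : r ^+ 2 * (1 + h) = 1.
  by rewrite sqr_sqrtr ?invr_ge0 ?addr_ge0// mulVf// gt_eqF// ltr_pwDl.
have Fmr : F = Phi (m * r).
  congr Phi; rewrite /m -mulrA; congr (_ * _).
  have -> : t + n%:R^-1 = t * (1 + h) by rewrite /h; field; rewrite !gt_eqF.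
  by rewrite sqrtrM ?(ltW t_gt0)// invfM /r sqrtrV// addr_ge0.
have := heat_scaling m h0 h1 (sqrtr_ge0 _) r2; rewrite -/r -Fmr => HS.
pose k := 4 * (q ^+ 2 + q ^+ 3) / n%:R.
have kn x : 4 * cub (x / Num.sqrt n%:R * q) <= k * (n%:R * cub (x / Num.sqrt n%:R)).
  have -> : k * (n%:R * cub (x / Num.sqrt n%:R)) =
      4 * ((q ^+ 2 + q ^+ 3) * cub (x / Num.sqrt n%:R)).
    by rewrite /k; field; rewrite gt_eqF.
  by rewrite ler_wpM2l// mulrC cubZ// ltW.
have mPhi' : measurable_fun [set: R]
    (fun x => Phi (((s + x) / Num.sqrt n%:R - a) / Num.sqrt t)).
  apply: (measurableT_comp (@measurable_Phi R)); apply: measurable_funM => //.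
  apply: measurable_funB => //; apply: measurable_funM => //.
  exact: measurable_funD.
have Phi01 x : 0 <= Phi (((s + x) / Num.sqrt n%:R - a) / Num.sqrt t) <= 1.
  by rewrite Phi_ge0 Phi_le1.
have argE x : ((s + x) / Num.sqrt n%:R - a) / Num.sqrt t = m + x / Num.sqrt n%:R * q.
  by rewrite /m /q; field; rewrite !gt_eqF.
have sqE x : (x / Num.sqrt n%:R * q) ^+ 2 = x ^+ 2 * h.
  rewrite !exprMn q2 exprVn sqr_sqrtr ?(ltW nR0)// /h; field.
  by rewrite !gt_eqF.
have eE : 33 * h ^+ 2 + k * L n <= e.
  rewrite /e [leRHS]mulrDl; apply: lerD.
    have -> : 33 * t0 ^- 2 / n%:R / n%:R = 33 * (t0^-1 / n%:R) ^+ 2.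
      by field; rewrite !gt_eqF.
    by rewrite ler_wpM2l// lerXn2r// nnegrE (le_trans h0).
  have -> : k * L n = 4 * (q ^+ 2 + q ^+ 3) * (L n / n%:R) by rewrite /k; ring.
  rewrite -[leRHS]mulrA ler_wpM2r ?mulr_ge0 ?lindeberg_ge0 ?invr_ge0 ?(ltW nR0)//.
  by rewrite ler_wpM2l// lerD// lerXn2r// nnegrE ltW// invr_gt0.
have [H1 H2] : Phi m - m * gpdf m * h / 2 - F <= 33 * h ^+ 2 /\
    - (33 * h ^+ 2) <= Phi m - m * gpdf m * h / 2 - F.
  by move: HS; rewrite ler_norml => /andP[].
split.
  apply: (@le_trans _ _ (Phi m + - (m * gpdf m * h / 2) + k * L n)%:E); last first.
    by rewrite lee_fin; lra.
  apply: (@integral_le_quadratic _ _ _ _ (X 0%N) EX EX2 n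
    (fun x => Phi (((s + x) / Num.sqrt n%:R - a) / Num.sqrt t)) _
    (gpdf m * (q / Num.sqrt n%:R))) => // x.
    by case/andP: (Phi01 x).
  have := Phi_taylor m (x / Num.sqrt n%:R * q); rewrite ler_norml => /andP[_].
  rewrite argE sqE; have := kn x.
  have -> : gpdf m * (x / Num.sqrt n%:R * q) = gpdf m * (q / Num.sqrt n%:R) * x by ring.
  have -> : m * gpdf m * (x ^+ 2 * h) / 2 = m * gpdf m * h / 2 * x ^+ 2 by ring.
  lra.
apply: (@le_trans _ _ ((Phi m + - (m * gpdf m * h / 2) + (- k) * L n) + e)%:E).
  by rewrite lee_fin; lra.
rewrite EFinD leeD2r//.
apply: (@integral_ge_quadratic _ _ _ _ (X 0%N) EX EX2 n
  (fun x => Phi (((s + x) / Num.sqrt n%:R - a) / Num.sqrt t)) _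
  (gpdf m * (q / Num.sqrt n%:R))) => // x.
have := Phi_taylor m (x / Num.sqrt n%:R * q); rewrite ler_norml => /andP[+ _].
rewrite argE sqE; have := kn x.
have -> : gpdf m * (x / Num.sqrt n%:R * q) = gpdf m * (q / Num.sqrt n%:R) * x by ring.
have -> : m * gpdf m * (x ^+ 2 * h) / 2 = m * gpdf m * h / 2 * x ^+ 2 by ring.
lra.
Qed.

End clt.

Section clt.
Context d (T : measurableType d) (R : realType) (P : probability T R).
Variable X : nat -> {RV P >-> R}.
Hypothesis Xindep : mutually_independent X.
Hypothesis Xident : identically_distributed X.
Hypothesis EX : (\int[P]_w (X 0%N w)%:E = 0)%E.
Hypothesis EX2 : (\int[P]_w (X 0%N w ^+ 2)%:E = 1)%E.

Local Notation L := (lindeberg (X 0%N)).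

Lemma surviveTT n i : survive X n (fun=> setT) i = setT.
Proof. by apply/seteqP; split. Qed.

Definition clt_error (t0 : R) (n : nat) : R := 33 * t0 ^- 2 / n%:R +
  4 * ((Num.sqrt t0)^-1 ^+ 2 + (Num.sqrt t0)^-1 ^+ 3) * L n.

Lemma clt_smooth (n : nat) (t0 a : R) : (0 < n)%N -> 0 < t0 -> n%:R^-1 <= t0 ->
  let F := Phi (- a / Num.sqrt (t0 + 1)) in
  let J := (\int[P]_w
    (Phi ((psum X n w / Num.sqrt n%:R - a) / Num.sqrt t0))%:E)%E in
  (J <= (F + clt_error t0 n)%:E)%E /\ (F%:E <= J + (clt_error t0 n)%:E)%E.
Proof.
move=> n0 t00 nt F J.
have nR0 : 0 < n%:R :> R by rewrite ltr0n.
(* Remaining Gaussian variance: t0 + 1 before the first step, t0 after the last. The residual t0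
   keeps away from the singularity of the heat solution at time 0. *)
pose t i : R := t0 + (n - i)%:R / n%:R.
pose phi i s := Phi ((s / Num.sqrt n%:R - a) / Num.sqrt (t i)).
pose e (i : nat) := clt_error t0 n / n%:R.
have mphi i : measurable_fun [set: R] (phi i).
  apply: (measurableT_comp (@measurable_Phi R)); apply: measurable_funM => //.
  by apply: measurable_funB => //; exact: measurable_funM.
have phi0 i s : 0 <= phi i s by exact: Phi_ge0.
have err0 : 0 <= clt_error t0 n.
  have q0 : 0 <= (Num.sqrt t0)^-1 by rewrite invr_ge0 sqrtr_ge0.
  apply: addr_ge0; first by rewrite !mulr_ge0// invr_ge0 ?exprn_ge0// ltW.
  apply: mulr_ge0; last exact: lindeberg_ge0.
  by apply: mulr_ge0 => //; apply: addr_ge0; exact: exprn_ge0.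
have e0 i : 0 <= e i by rewrite mulr_ge0// invr_ge0 ltW.
have step i s : (0 <= i < n)%N ->
    (\int[P]_w (phi i.+1 (s + X 0%N w))%:E <= (phi i s + e i)%:E)%E /\
    ((phi i s)%:E <= \int[P]_w (phi i.+1 (s + X 0%N w))%:E + (e i)%:E)%E.
  move=> /andP[_ iltn].
  have tS : t i = t i.+1 + n%:R^-1.
    rewrite /t -addrA; congr (_ + _).
    rewrite -[X in _ + X]mul1r -mulrDl; congr (_ / _).
    by rewrite -(natrD _ _ 1) addn1 subnSK.
  rewrite /phi tS; apply: clt_step => //.
  by rewrite lerDl mulr_ge0// invr_ge0 ltW.
have J0 : (\int[P]_w (phi 0%N (psum X 0 w))%:E = F%:E)%E.
  rewrite (eq_integral (cst F%:E)); last first.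
    move=> w _; rewrite /phi /psum big_ord0 mul0r sub0r /t subn0 divff//.
    by rewrite gt_eqF.
  by have := expectation_cst P F; rewrite unlock.
have Jn : (\int[P]_w (phi n (psum X n w))%:E = J)%E.
  by apply: eq_integral => w _; rewrite /phi /t subnn mul0r addr0.
have esum : \sum_(0 <= i < n) e i = clt_error t0 n.
  rewrite /e; move: (clt_error t0 n) => z.
  rewrite sumr_const_nat subn0 -[LHS]mulr_natr divfK; first by [].
  by rewrite gt_eqF.
clearbody phi e F J; split.
  have := @stopped_upper _ _ _ P X 0%N (fun=> setT) (fun=> measurableT)
    Xindep Xident phi e 0 mphi phi0 e0 (lexx _) n (leq0n n).
  rewrite surviveTT setCT measure0 mule0 adde0 J0 esum Jn; apply => //.
  by move=> i s /(step i s)[].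
have := @stopped_lower _ _ _ P X 0%N (fun=> setT) (fun=> measurableT)
  Xindep Xident phi e 0 mphi phi0 e0 n (leq0n n).
rewrite surviveTT setCT measure0 mule0 adde0 J0 esum Jn; apply => //.
  by move=> i s /(step i s)[].
by move=> i s _ [].
Qed.

Lemma clt_error_cvg0 t0 : clt_error t0 n @[n --> \oo] --> 0.
Proof.
rewrite -[X in _ --> X]addr0; apply: cvgD.
  rewrite -[X in _ --> X](mulr0 (33 * t0 ^- 2)); apply: cvgM; first exact: cvg_cst.
  apply/gtr0_cvgV0; last exact: cvgr_idn.
  by near=> n; rewrite ltr0n; near: n; exact: nbhs_infty_gt.
rewrite -[X in _ --> X](mulr0 (4 * ((Num.sqrt t0)^-1 ^+ 2 + (Num.sqrt t0)^-1 ^+ 3))).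
apply: cvgM; first exact: cvg_cst.
exact: lindeberg_cvg0.
Unshelve. all: by end_near. Qed.

Lemma measurable_psum_gt (b k : R) n : measurable [set w | b < psum X n w / k].
Proof.
have mf : measurable_fun [set: T] (fun w => psum X n w / k).
  by apply: measurable_funM => //; exact: measurable_psum.
rewrite (_ : mkset _ = (fun w => psum X n w / k) @^-1` `]b, +oo[).
  by rewrite -[Y in measurable Y]setTI; exact: mf.
by apply/seteqP; split=> w /=; rewrite in_itv/= andbT.
Qed.

(** The indicator of ]b, +oo[ is squeezed, up to e, between copies of Phi (y / sqrt t0) centred at b
    + eta and b - eta, whose means [clt_smooth] computes in the limit. The three parts of e0 pay for
    the squeeze, for [clt_error], and for moving the limits back to b. *)
Lemma clt (b : R) :
  fine (P [set w | b < psum X n w / Num.sqrt n%:R]) @[n --> \oo] --> 1 - Phi b.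
Proof.
rewrite -PhiN; apply/cvgrPdist_le => e0 e00.
pose e := e0 / 3; have e_gt0 : 0 < e by rewrite divr_gt0.
have [x0 x00 Phix0] := Phi_near1 e_gt0.
(* The limiting smoothed mean at level b + u when sqrt t0 = |u| / x0; its continuity at 0 supplies
   eta. *)
pose G (u : R) := Phi (- (b + u) / Num.sqrt ((u / x0) ^+ 2 + 1)).
have G0 : G 0 = Phi (- b).
  by rewrite /G mul0r expr0n/= add0r sqrtr1 divr1 addr0.
have cG : {for 0, continuous G}.
  apply: continuous_comp; last exact: continuous_Phi.
  apply: cvgM; first by apply: cvgN; apply: cvgD; [exact: cvg_cst|exact: cvg_id].
  apply: cvgV; first by rewrite mul0r expr0n/= add0r sqrtr1 oner_neq0.
  apply: (@cvg_comp _ _ _ (fun u : R => (u / x0) ^+ 2 + 1) Num.sqrt _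
    (nbhs ((0 / x0) ^+ 2 + 1))); last exact: sqrt_continuous.
  apply: cvgD; last exact: cvg_cst.
  apply: (@cvg_comp _ _ _ (fun u : R => u / x0) (fun y => y ^+ 2) _
    (nbhs (0 / x0))); last exact: sqr_continuous.
  by apply: cvgM; [exact: cvg_id|exact: cvg_cst].
have [eta eta0 [Gp Gm]] : exists2 u, 0 < u &
    `|Phi (- b) - G u| <= e /\ `|Phi (- b) - G (- u)| <= e.
  move/cvgrPdist_le : cG => /(_ _ e_gt0); rewrite G0 => -[/= u u0 Hu].
  have u2 : 0 < u / 2 by rewrite divr_gt0.
  exists (u / 2) => //; split; apply: Hu => /=.
    by rewrite sub0r normrN gtr0_norm//; lra.
  by rewrite sub0r opprK gtr0_norm//; lra.
(* A displacement eta is then x0 standard deviations of the smoothing, beyond which [Phi] is within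
   e of its limits. *)
pose t0 := (eta / x0) ^+ 2.
have t00 : 0 < t0 by rewrite exprn_gt0// divr_gt0.
have st0 : Num.sqrt t0 = eta / x0 by rewrite sqrtr_sqr gtr0_norm// divr_gt0.
near=> n.
have n0 : (0 < n)%N by near: n; exact: nbhs_infty_gt.
have nt0 : n%:R^-1 <= t0.
  rewrite -[leRHS]invrK lef_pV2 ?posrE ?invr_gt0 ?ltr0n//.
  by near: n; exact: nbhs_infty_ger.
have err : clt_error t0 n <= e.
  near: n; have /cvgrPdist_le /(_ _ e_gt0) := clt_error_cvg0 t0.
  apply: filterS => n; rewrite sub0r normrN; apply: le_trans; exact: ler_norm.
have [up _] := @clt_smooth n t0 (b - eta) n0 t00 nt0.
have [_ lo] := @clt_smooth n t0 (b + eta) n0 t00 nt0.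
set A := [set w | b < psum X n w / Num.sqrt n%:R].
have mA : measurable A by exact: measurable_psum_gt.
pose J a w : R := Phi ((psum X n w / Num.sqrt n%:R - a) / Num.sqrt t0).
have mJ a : measurable_fun [set: T] (fun w => (J a w)%:E).
  apply/measurable_EFinP; apply: (measurableT_comp (@measurable_Phi R)).
  apply: measurable_funM => //; apply: measurable_funB => //.
  by apply: measurable_funM => //; exact: measurable_psum.
have pA : P A = (fine (P A))%:E by rewrite fineK// fin_num_measure.
have PA_le : fine (P A) <= Phi (- (b - eta) / Num.sqrt (t0 + 1)) +
    clt_error t0 n + e.
  rewrite -lee_fin -pA EFinD; apply: le_trans (leeD2r _ up).
  have -> : P A = (\int[P]_w (\1_A w)%:E)%E by rewrite integral_indic// setIT.
  have <- : (\int[P]_w (J (b - eta) w + e)%:E = \int[P]_w (J (b - eta) w)%:E + e%:E)%E.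
    rewrite (eq_integral (fun w => (J (b - eta) w)%:E + (cst e%:E) w)%E)//.
    rewrite ge0_integralD//.
    - by congr (_ + _)%E; have := expectation_cst P e; rewrite unlock.
    - by move=> w _; rewrite lee_fin Phi_ge0.
    - by move=> w _; rewrite lee_fin ltW.
  apply: ge0_le_integral => //.
  - by apply/measurable_EFinP; exact: measurable_indic.
  - by under eq_fun do rewrite EFinD; exact: emeasurable_funD.
  move=> w _; rewrite lee_fin indicE; have [|_] := boolP (w \in A); last first.
    by rewrite addr_ge0 ?Phi_ge0 ?ltW.
  rewrite inE /A/= => bw.
  suff h : Phi x0 <= J (b - eta) w.
    by move: h Phix0; clear; rewrite /J; lra.
  apply: le_Phi; rewrite st0 invf_div mulrA ler_pdivlMr// mulrC ler_wpM2r ?(ltW x00)//.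
  by move: bw; clear; lra.
have PA_ge : Phi (- (b + eta) / Num.sqrt (t0 + 1)) <=
    fine (P A) + e + clt_error t0 n.
  rewrite -lee_fin [leRHS]EFinD; apply: le_trans lo _; rewrite leeD2r//.
  rewrite EFinD -pA.
  have -> : P A = (\int[P]_w (\1_A w)%:E)%E by rewrite integral_indic// setIT.
  have <- : (\int[P]_w (\1_A w + e)%:E = \int[P]_w (\1_A w)%:E + e%:E)%E.
    rewrite (eq_integral (fun w => (\1_A w)%:E + (cst e%:E) w)%E)//.
    rewrite ge0_integralD//.
    - by congr (_ + _)%E; have := expectation_cst P e; rewrite unlock.
    - by apply/measurable_EFinP; exact: measurable_indic.
    - by move=> w _; rewrite lee_fin ltW.
  apply: ge0_le_integral => //.
  - by move=> w _; rewrite lee_fin Phi_ge0.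
  - exact: (mJ (b + eta)).
  - by apply/measurable_EFinP; exact: measurable_funD.
  move=> w _; rewrite lee_fin indicE; have [|] := boolP (w \in A).
    move=> _; have := Phi_le1 ((psum X n w / Num.sqrt n%:R - (b + eta)) / Num.sqrt t0).
    by have := e_gt0; clear; rewrite /=; lra.
  rewrite notin_setE /A/= => /negP; rewrite -leNgt => bw.
  suff h : J (b + eta) w <= Phi (- x0).
    by move: h Phix0; clear; rewrite /J PhiN /=; lra.
  apply: le_Phi; rewrite st0 invf_div mulrA ler_pdivrMr//.
  have -> : - x0 * eta = (- eta) * x0 by ring.
  by rewrite ler_wpM2r ?(ltW x00)//; move: bw; clear; lra.
have {}Gp : Phi (- b) - Phi (- (b + eta) / Num.sqrt (t0 + 1)) <= e.
  by apply: le_trans Gp; exact: ler_norm.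
have {}Gm : Phi (- (b - eta) / Num.sqrt (t0 + 1)) - Phi (- b) <= e.
  apply: le_trans Gm; rewrite distrC; apply: le_trans (ler_norm _).
  by rewrite /G (mulNr eta) sqrrN.
have e3 : e0 = e + e + e by rewrite /e; field.
rewrite ler_norml e3; move: PA_le PA_ge err Gp Gm; clear => *.
by apply/andP; split; lra.
Unshelve. all: by end_near. Qed.
End clt.

(** * Tail probabilities determine convergence in distribution *)

Section uniform_continuity.
Context {R : realType}.

Lemma segment_unif_continuous (f : R -> R) (a b e : R) : continuous f -> 0 < e ->
  exists2 dlt, 0 < dlt & forall x y, a <= x <= b -> `|x - y| <= dlt ->
    `|f x - f y| <= e.
Proof.
move=> cf e0.
have := @segment_compact R a b => /compact_near_coveringP.
move=> /(_ R 0^'+ (fun dlt x => forall y, `|x - y| <= dlt -> `|f x - f y| <= e)).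
move=> /(_ _) [].
  move=> x _.
  have /cvgrPdist_le /(_ (e / 2)) : f u @[u --> x] --> f x by exact: cf.
  rewrite divr_gt0// => /(_ isT)[/= r r0 Hr].
  exists (ball x (r / 2), [set dlt | dlt < r / 2]).
    split => /=; first by apply: nbhsx_ballx; rewrite divr_gt0.
    by apply: nbhs_right_lt; rewrite divr_gt0.
  move=> [x' dlt] /= [xx' dr] y x'y.
  have h1 : `|f x - f x'| <= e / 2.
    by apply: Hr => /=; apply: lt_le_trans xx' _; rewrite ler_pdivrMr//; lra.
  have h2 : `|f x - f y| <= e / 2.
    apply: Hr => /=; have -> : x - y = (x - x') + (x' - y) by ring.
    apply: le_lt_trans (ler_normD _ _) _.
    by move: xx'; rewrite /ball/=; lra.
  have -> : f x' - f y = (f x - f y) - (f x - f x') by ring.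
  by apply: le_trans (ler_normB _ _) _; lra.
move=> u /= u0 Hu; exists (u / 2); first by rewrite divr_gt0.
move=> x y /andP[ax xb].
apply: (Hu (u / 2)) => /=.
- by rewrite sub0r normrN gtr0_norm ?divr_gt0//; lra.
- by rewrite divr_gt0.
- by rewrite in_itv/= ax xb.
Qed.

End uniform_continuity.

(** * Expectations from finitely many tail probabilities *)

Section step_approximation.
Context d (T : measurableType d) (R : realType) (P : probability T R).
Variables (V : {RV P >-> R}) (f : R -> R) (B : R).
Hypothesis cf : continuous f.
Hypothesis fB : forall x, `|f x| <= B.

Definition tailp (c : R) : R := fine (ccdf V c).

Let ind (c : R) (w : T) : R := \1_[set w | c < V w] w.

Let indE c w : ind c w = (c < V w)%R%:R.
Proof.
rewrite /ind indicE; congr (_%:R); congr nat_of_bool; apply/idP/idP.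
  by rewrite inE.
by move=> h; rewrite inE.
Qed.

Let mind_set c : measurable [set w | c < V w].
Proof.
rewrite (_ : mkset _ = V @^-1` `]c, +oo[).
  by rewrite -[Y in measurable Y]setTI; exact: measurable_funPT.
by apply/seteqP; split=> w /=; rewrite in_itv/= andbT.
Qed.

Lemma tailpE c : tailp c = fine (P [set w | c < V w]).
Proof.
congr (fine (P _)).
by apply/seteqP; split=> w /=; rewrite in_itv/= andbT.
Qed.

Let bounded_integrable (g : T -> R) (M : R) : measurable_fun [set: T] g ->
  (forall w, `|g w| <= M) -> P.-integrable [set: T] (EFin \o g).
Proof.
move=> mg gM; apply: (@le_integrable _ _ _ _ _ _ _ (EFin \o cst M)) => //.
- exact/measurable_EFinP.
- by move=> w _ /=; rewrite lee_fin; apply: le_trans (gM w) (ler_norm _).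
- exact: finite_measure_integrable_cst.
Qed.

Let integrable_ind c : P.-integrable [set: T] (EFin \o ind c).
Proof.
apply: (@bounded_integrable _ 1); first exact: measurable_indic.
by move=> w; rewrite indE; case: (_ < _)%R; rewrite ?normr1 ?normr0.
Qed.

Let Rintegral_ind c : \int[P]_w ind c w = tailp c.
Proof. by rewrite /Rintegral integral_indic// setIT tailpE. Qed.

Variables (K : R) (m : nat) (e : R).
Hypothesis K0 : 0 < K.
Let node (j : nat) : R := - K + j%:R * (2 * K / m.+1%:R).
Hypothesis e0 : 0 <= e.
Hypothesis fe : forall x y, - K <= x <= K -> `|x - y| <= 2 * K / m.+1%:R ->
  `|f x - f y| <= e.

Let step n w : R := \sum_(0 <= j < n) f (node j) * (ind (node j) w - ind (node j.+1) w).

Let integrable_step n : P.-integrable [set: T] (EFin \o step n).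
Proof.
elim: n => [|n IH].
  rewrite (_ : EFin \o _ = EFin \o cst 0); last first.
    by apply/funext => w; rewrite /step /= big_geq.
  exact: finite_measure_integrable_cst.
rewrite (_ : EFin \o _ = fun w => (step n w)%:E +
    (f (node n))%:E * ((ind (node n) w)%:E - (ind (node n.+1) w)%:E))%E; last first.
  by apply/funext => w; rewrite /step /= big_nat_recr//= EFinD EFinM EFinB.
apply: integrableD => //; apply: integrableZl => //.
exact: (integrableB _ (integrable_ind _) (integrable_ind _)).
Qed.

Let Rintegral_step n : \int[P]_w step n w =
  \sum_(0 <= j < n) f (node j) * (tailp (node j) - tailp (node j.+1)).
Proof.
elim: n => [|n IH].
  rewrite big_geq// /step; under eq_Rintegral do rewrite big_geq//.
  by rewrite Rintegral_cst// mul0r.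
rewrite big_nat_recr//= -IH /step.
under eq_Rintegral do rewrite big_nat_recr//=.
have iB : P.-integrable setT (EFin \o (fun w => ind (node n) w - ind (node n.+1) w)).
  exact: (integrableB _ (integrable_ind _) (integrable_ind _)).
rewrite RintegralD//; last 2 first.
- exact: integrable_step.
- exact: (integrableZl _ _ iB).
by rewrite RintegralZl// RintegralB// !Rintegral_ind.
Qed.

Lemma expectation_step_approx :
  `|\int[P]_w f (V w) - \sum_(0 <= j < m.+1)
      f (node j) * (tailp (node j) - tailp (node j.+1))| <=
  e + B * (1 - tailp (- K) + tailp K).
Proof.
have mf : measurable_fun [set: T] (fun w => f (V w)).
  apply: measurableT_comp => //; exact: continuous_measurable_fun.
have intf : P.-integrable setT (EFin \o (fun w => f (V w))).
  exact: (bounded_integrable mf (fun w => fB (V w))).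
have nodeS j : node j.+1 = node j + 2 * K / m.+1%:R.
  by rewrite /node -natr1; ring.
have nodem : node m.+1 = K.
  by rewrite /node mulrC divfK ?pnatr_eq0//; ring.
have node0 : node 0 = - K by rewrite /node mul0r addr0.
have node_le j : node j <= node j.+1.
  by rewrite nodeS lerDl divr_ge0// mulr_ge0// ltW.
have le_node j k : (j <= k)%N -> node j <= node k.
  elim: k => [|k IH]; first by rewrite leqn0 => /eqP ->.
  rewrite leq_eqVlt => /orP[/eqP ->//|/IH h]; exact: le_trans h (node_le k).
rewrite -Rintegral_step -(RintegralB _ intf (integrable_step m.+1))//.
have ifg : P.-integrable setT (EFin \o (fun w => f (V w) - step m.+1 w)).
  exact: (integrableB _ intf (integrable_step _)).
apply: le_trans (le_normr_Rintegral _ ifg) _ => //.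
pose bnd w := e + B * (1 - ind (- K) w + ind K w).
have i1 := @finite_measure_integrable_cst _ _ _ P setT 1 measurableT.
have i2 : P.-integrable setT (EFin \o (fun w => 1 - ind (- K) w)).
  exact: (integrableB _ i1 (integrable_ind _)).
have i3 : P.-integrable setT (EFin \o (fun w => 1 - ind (- K) w + ind K w)).
  exact: (integrableD _ i2 (integrable_ind _)).
have i4 : P.-integrable setT (EFin \o (fun w => B * (1 - ind (- K) w + ind K w))).
  exact: (integrableZl _ _ i3).
have i5 := @finite_measure_integrable_cst _ _ _ P setT e measurableT.
have i6 : P.-integrable setT (EFin \o bnd).
  exact: (integrableD _ i5 i4).
have -> : e + B * (1 - tailp (- K) + tailp K) = \int[P]_w bnd w.
  rewrite (RintegralD _ i5 i4)// (RintegralZl _ _ i3)// (RintegralD _ i2)//.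
  rewrite (RintegralB _ i1)// !Rintegral_ind.
  have Ecst k : \int[P]_w (cst k w) = k.
    by rewrite /Rintegral; have := expectation_cst P k; rewrite unlock => ->.
  by rewrite !Ecst.
apply: le_Rintegral => //; first exact: integrable_norm.
move=> w _ /=.
have tele : \sum_(0 <= j < m.+1) (ind (node j) w - ind (node j.+1) w) =
    ind (- K) w - ind K w.
  rewrite -node0 -[in RHS]nodem -[RHS]opprB
    -(telescope_sumr (fun j => ind (node j) w) (leq0n m.+1)) -sumrN.
  by apply: eq_bigr => j _; rewrite opprB.
(* The differences of indicators telescope to the indicator of - K < V <= K. Outside, the step
   function is 0 and |f| <= B; inside, exactly one difference is 1, with V within one mesh of its
   node. *)
have -> : f (V w) - step m.+1 w = f (V w) * (1 - ind (- K) w + ind K w) +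
    \sum_(0 <= j < m.+1) (f (V w) - f (node j)) * (ind (node j) w - ind (node j.+1) w).
  under eq_bigr do rewrite mulrBl.
  by rewrite sumrB -mulr_sumr tele -/(step _ w); ring.
have indle c c' : c <= c' -> ind c' w <= ind c w.
  by rewrite !indE => cc'; case: (ltP c' (V w)) => // h; rewrite (le_lt_trans cc' h).
have ind01 c : 0 <= ind c w <= 1.
  by rewrite indE; case: (_ < _) => /=; rewrite ?lexx ?ler01.
apply: le_trans (ler_normD _ _) _; rewrite addrC; apply: lerD; last first.
  rewrite normrM; apply: ler_pM => //.
  have /andP[? ?] := ind01 (- K); have /andP[? ?] := ind01 K.
  by rewrite ger0_norm//; lra.
apply: le_trans (ler_norm_sum _ _ _) _.
apply: (@le_trans _ _ (\sum_(0 <= j < m.+1) e * (ind (node j) w - ind (node j.+1) w))).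
  rewrite big_nat_cond [leRHS]big_nat_cond; apply: ler_sum => j /andP[/andP[_ jm] _].
  have := indle _ _ (node_le j); rewrite normrM.
  rewrite !indE; case: (ltP (node j) (V w)) => [h1|h1]; last first.
    case: (ltP (node j.+1) (V w)) => [h2|h2]; last by rewrite subrr normr0 !mulr0.
    by rewrite /= ler10.
  case: (ltP (node j.+1) (V w)) => [h2|h2] _ /=; first by rewrite subrr normr0 !mulr0.
  rewrite subr0 normr1 !mulr1; apply: fe.
    apply/andP; split.
      by rewrite -node0; apply: le_trans (ltW h1); exact: le_node.
    by rewrite -nodem; apply: le_trans h2 _; exact: le_node.
  rewrite ger0_norm ?subr_ge0 ?(ltW h1)//.
  by rewrite lerBlDl -nodeS.
rewrite -mulr_sumr tele -[leRHS]mulr1 ler_wpM2l//.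
by have /andP[? ?] := ind01 (- K); have /andP[? ?] := ind01 K; lra.
Qed.

End step_approximation.

(** The step approximation has an error controlled by tails at K and - K, and its mean is a finite
    combination of tails. Convergence is asked at every c, which suits limits with a continuous
    distribution function such as N(0,1) and |Z|. *)
Lemma cvg_in_distribution_tail d (T : measurableType d) (R : realType)
    (P : probability T R) d' (T' : measurableType d') (P' : probability T' R)
    (V : nat -> {RV P >-> R}) (V' : {RV P' >-> R}) :
  (forall c, tailp (V n) c @[n --> \oo] --> tailp V' c) ->
  cvg_in_distribution V V'.
Proof.
move=> Vc f cf [M [_ fM]].
pose B := `|M| + 1.
have fB x : `|f x| <= B by apply: fM => //; rewrite ltr_pwDr// ler_norm.
have B0 : 0 < B by rewrite ltr_pwDr.
have fin d0 (T0 : measurableType d0) (P0 : probability T0 R) (W : {RV P0 >-> R}) :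
    ('E_P0[f \o W] = (\int[P0]_w f (W w))%:E)%E.
  have mf : measurable_fun [set: T0] (fun w => f (W w)).
    by apply: measurableT_comp => //; exact: continuous_measurable_fun.
  rewrite unlock fineK//; apply: integrable_fin_num => //.
  apply: (@le_integrable _ _ _ _ _ _ _ (EFin \o cst B)) => //.
  - exact/measurable_EFinP.
  - by move=> w _ /=; rewrite lee_fin; apply: le_trans (fB _) (ler_norm _).
  - exact: finite_measure_integrable_cst.
rewrite fin; under eq_fun do rewrite fin.
apply: cvg_EFin; first by near=> n.
apply/cvgrPdist_le => e0 e00.
(* Two parts for each of the two step approximations (oscillation and tails), one for the finite
   sums. *)
pose e := e0 / 5; have e_gt0 : 0 < e by rewrite divr_gt0.
have eB : 0 < e / (4 * B) by rewrite divr_gt0// mulr_gt0.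
(* [K] depends on the limit only. Each of its two tails is at most e / (4 B); for [V n] with n large
   each is at most twice that, so both together cost at most e after multiplication by B. *)
have [K K0 [K1 K2]] : exists2 K, 0 < K &
    tailp V' K <= e / (4 * B) /\ 1 - tailp V' (- K) <= e / (4 * B).
  have h1 : \forall x \near +oo, tailp V' x <= e / (4 * B).
    have /fine_cvgP[_] := cvg_ccdfy0 V'; move/cvgrPdist_le => /(_ _ eB).
    apply: filterS => x; rewrite sub0r normrN; apply: le_trans; exact: ler_norm.
  have h2 : \forall x \near +oo, 1 - tailp V' (- x) <= e / (4 * B).
    have /fine_cvgP[_] := cvg_ccdfNy1 V'; move/cvgrPdist_le => /(_ _ eB) h.
    have : \forall x \near -oo, 1 - tailp V' x <= e / (4 * B).
      by apply: filterS h => x; apply: le_trans; exact: ler_norm.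
    by move=> [u [ur Hu]]; exists (- u); split; [rewrite realN|move=> x ux; apply: Hu; rewrite ltrNl].
  have : \forall x \near +oo, 0 < x /\
      (tailp V' x <= e / (4 * B) /\ 1 - tailp V' (- x) <= e / (4 * B)).
    near=> x; split; first by near: x; exact: nbhs_pinfty_gt.
    by split; near: x.
  by move=> /filter_ex[x [x0 x12]]; exists x.
have [dlt dlt0 Hd] := segment_unif_continuous (- K) K cf e_gt0.
have [m Hm] : exists m, 2 * K / m.+1%:R <= dlt.
  have K2d : 0 <= 2 * K / dlt by rewrite divr_ge0 ?mulr_ge0// ltW.
  exists (Num.truncn (2 * K / dlt)).
  rewrite ler_pdivrMr// -ler_pdivrMl// mulrC ltW//.
  by have /andP[] := truncn_itv K2d.
have fe x y : - K <= x <= K -> `|x - y| <= 2 * K / m.+1%:R -> `|f x - f y| <= e.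
  by move=> h1 h2; apply: Hd => //; exact: le_trans Hm.
have Hn n := expectation_step_approx (V n) cf fB K0 (ltW e_gt0) fe.
have H' := expectation_step_approx V' cf fB K0 (ltW e_gt0) fe.
set node := fun j : nat => - K + j%:R * (2 * K / m.+1%:R) in Hn H'.
pose D W : R := \sum_(0 <= j < m.+1) f (node j) * (W (node j) - W (node j.+1)).
have cvgD' : D (tailp (V n)) @[n --> \oo] --> D (tailp V').
  rewrite /D; elim: (index_iota 0 m.+1) => [|j s IH].
    by rewrite big_nil; under eq_fun do rewrite big_nil; exact: cvg_cst.
  rewrite big_cons; under eq_fun do rewrite big_cons.
  apply: cvgD IH; apply: cvgM; first exact: cvg_cst.
  by apply: cvgB; exact: Vc.
near=> n.
have sumn : `|D (tailp V') - D (tailp (V n))| <= e.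
  by near: n; move/cvgrPdist_le : cvgD'; apply.
have tK : tailp (V n) K <= tailp V' K + e / (4 * B).
  have : `|tailp V' K - tailp (V n) K| <= e / (4 * B).
    by near: n; have /cvgrPdist_le := Vc K; apply.
  by rewrite ler_norml => /andP[h _]; move: h; clear; lra.
have tNK : tailp V' (- K) - e / (4 * B) <= tailp (V n) (- K).
  have : `|tailp V' (- K) - tailp (V n) (- K)| <= e / (4 * B).
    by near: n; have /cvgrPdist_le := Vc (- K); apply.
  by rewrite ler_norml => /andP[_ h]; move: h; clear; lra.
have B4 : B * (4 * (e / (4 * B))) = e by field; rewrite gt_eqF.
have bn : B * (1 - tailp (V n) (- K) + tailp (V n) K) <= e.
  rewrite -[leRHS]B4 ler_wpM2l ?(ltW B0)//.
  by move: tK tNK K1 K2; clear; lra.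
have b' : B * (1 - tailp V' (- K) + tailp V' K) <= e.
  rewrite -[leRHS]B4 ler_wpM2l ?(ltW B0)//.
  by have := eB; move: K1 K2; clear; lra.
have := le_trans (Hn n) (lerD (lexx e) bn).
have := le_trans H' (lerD (lexx e) b').
rewrite -/(D (tailp V')) -/(D (tailp (V n))).
rewrite /= -/(Rintegral P setT (fun w => f (V n w))).
move: sumn; move: (D _) (D _) (\int[_]__ _) (\int[_]__ _) => D1 D2 I1 I2.
have -> : e0 = e + e + e + e + e by rewrite /e; field.
clear; rewrite !ler_norml => /andP[? ?] /andP[? ?] /andP[? ?].
by apply/andP; split; lra.
Unshelve. all: by end_near. Qed.

(** * Hajek-Renyi inequality *)

Section maximal.
Context d (T : measurableType d) (R : realType) (P : probability T R).
Variable X : nat -> {RV P >-> R}.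
Hypothesis Xindep : mutually_independent X.
Hypothesis Xident : identically_distributed X.
Hypothesis EX : (\int[P]_w (X 0%N w)%:E = 0)%E.
Hypothesis EX2 : (\int[P]_w (X 0%N w ^+ 2)%:E = 1)%E.

(** The stopping lemma with nothing to stop: the square grows by 1 per step in mean. *)
Lemma integral_psum_sqr n : (\int[P]_w (psum X n w ^+ 2)%:E <= n%:R%:E)%E.
Proof.
have mphi (i : nat) : measurable_fun [set: R] (fun s : R => s ^+ 2).
  exact: measurable_funX.
have phi0 (i : nat) (s : R) : 0 <= s ^+ 2 by exact: sqr_ge0.
have e0 (i : nat) : 0 <= (fun=> 1 : R) i by exact: ler01.
have h := @stopped_upper _ _ _ P X 0%N (fun=> setT) (fun=> measurableT)
    Xindep Xident (fun _ s => s ^+ 2) (fun=> 1) 0 mphi phi0 e0 (lexx _) n (leq0n n).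
move: h; rewrite (_ : survive _ _ _ _ = setT); last by apply/seteqP; split.
rewrite setCT measure0 mule0 adde0 => h; apply: (le_trans (h _ _)).
- by move=> i s _ _; rewrite integral_sqr_translate.
- by move=> i s _ _; exact: sqr_ge0.
rewrite (eq_integral (cst 0%E)); last first.
  by move=> w _; rewrite /psum big_ord0 expr0n.
by rewrite integral0 add0e sumr_const_nat subn0.
Qed.

Definition below (x : R) (i : nat) : set R := [set s | s / i%:R <= x].

Lemma measurable_below x i : measurable (below x i).
Proof.
have mf : measurable_fun [set: R] (fun s : R => s / i%:R) by exact: measurable_funM.
rewrite (_ : below x i = (fun s : R => s / i%:R) @^-1` `]-oo, x]).
  by rewrite -[Y in measurable Y]setTI; exact: mf.
by apply/seteqP; split=> w /=; rewrite in_itv.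
Qed.

Local Notation survive_below N x M := (survive X N (below x) M).

Lemma sum_inv_sqr (N M : nat) : (0 < N <= M)%N ->
  \sum_(N <= i < M) (i.+1%:R ^- 2 : R) <= N%:R^-1 - M%:R^-1.
Proof.
move=> /andP[N0]; elim: M => [|M IH].
  by rewrite leqn0 => /eqP N00; rewrite N00 in N0.
rewrite leq_eqVlt => /orP[/eqP <-|]; first by rewrite big_geq// subrr.
rewrite ltnS => NM; rewrite big_nat_recr//=.
have M0 : 0 < M%:R :> R by rewrite ltr0n (leq_trans N0).
have h := IH NM.
suff h2 : M.+1%:R ^- 2 <= M%:R^-1 - M.+1%:R^-1 :> R.
  by apply: le_trans (lerD h h2) _; rewrite addrA subrK.
have -> : M%:R^-1 - M.+1%:R^-1 = (M%:R * M.+1%:R)^-1 :> R.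
  by rewrite -natr1; field; apply/andP; split; lra.
rewrite lef_pV2 ?posrE ?mulr_gt0 ?exprn_gt0 ?ltr0n ?(leq_trans N0 NM)//.
by rewrite expr2 ler_wpM2r ?ler_nat.
Qed.

(** The 2 is 1 + 1: the second moment of S_N / N is at most 1/N, and the increments 1/(i+1)^2 from
    time N on sum to at most 1/N by telescoping. *)
Lemma hajek_renyi_finite (N M : nat) (x : R) : (0 < N <= M)%N -> 0 < x ->
  (P (~` survive_below N x M) <= (2 / (N%:R * x ^+ 2))%:E)%E.
Proof.
move=> /andP[N0 NM] x0.
have NR0 : 0 < N%:R :> R by rewrite ltr0n.
have mphi i : measurable_fun [set: R] (fun s : R => (s / i%:R) ^+ 2).
  by apply: measurable_funX; exact: measurable_funM.
have phi0 (i : nat) (s : R) : 0 <= (s / i%:R) ^+ 2 by exact: sqr_ge0.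
have e0 (i : nat) : 0 <= i.+1%:R ^- 2 :> R by rewrite invr_ge0 exprn_ge0.
have h := @stopped_upper _ _ _ P X N (below x) (measurable_below x)
    Xindep Xident (fun i s => (s / i%:R) ^+ 2) (fun i => i.+1%:R ^- 2) (x ^+ 2)
    mphi phi0 e0 (sqr_ge0 _) M NM.
have H : ((x ^+ 2)%:E * P (~` survive_below N x M) <= (2 / N%:R)%:E)%E.
  apply: le_trans (le_trans (leeDr _ _) (h _ _)) _.
  - by apply: integral_ge0 => w _; rewrite lee_fin sqr_ge0.
  - move=> i s /andP[Ni _] _.
    have i0 : 0 < i%:R :> R by rewrite ltr0n (leq_trans N0).
    rewrite (_ : (fun w => _) = fun w => ((i.+1%:R ^- 2)%:E * ((s + X 0%N w) ^+ 2)%:E)%E); last first.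
      by apply/funext => w; rewrite -EFinM expr_div_n mulrC.
    rewrite ge0_integralZl_EFin; first last.
    + by rewrite invr_ge0 exprn_ge0.
    + by apply/measurable_EFinP; apply: measurable_funX; exact: measurable_funD.
    + by move=> w _; rewrite lee_fin sqr_ge0.
    + exact: measurableT.
    rewrite integral_sqr_translate// -EFinM lee_fin mulrDr mulr1 lerD2r.
    rewrite expr_div_n mulrC ler_wpM2l ?sqr_ge0//.
    by rewrite lef_pV2 ?posrE ?exprn_gt0// lerXn2r ?nnegrE ?ler_nat.
  - move=> i s Ni /= /negP; rewrite /below/= -ltNge => xs.
    by rewrite lerXn2r ?nnegrE ?(ltW x0) ?(ltW xs)// (le_trans (ltW x0))// ltW.
  - rewrite (_ : (fun w => _) = fun w => ((N%:R ^- 2)%:E * (psum X N w ^+ 2)%:E)%E); last first.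
      by apply/funext => w; rewrite -EFinM expr_div_n mulrC.
    rewrite ge0_integralZl_EFin; first last.
    + by rewrite invr_ge0 exprn_ge0.
    + by apply/measurable_EFinP; apply: measurable_funX; exact: measurable_psum.
    + by move=> w _; rewrite lee_fin sqr_ge0.
    + exact: measurableT.
    apply: (@le_trans _ _ ((N%:R ^- 2)%:E * N%:R%:E + (N%:R^-1)%:E)%E).
      apply: leeD.
        by rewrite lee_wpmul2l ?integral_psum_sqr// lee_fin invr_ge0 exprn_ge0.
      rewrite lee_fin (le_trans (sum_inv_sqr _))// ?N0// gerBl invr_ge0//.
    rewrite -EFinM -EFinD lee_fin le_eqVlt; apply/orP; left; apply/eqP.
    by field; rewrite gt_eqF.
have pE : P (~` survive_below N x M) = (fine (P (~` survive_below N x M)))%:E.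
  rewrite fineK// fin_num_measure//; apply: measurableC.
  by apply: measurable_survive; exact: measurable_below.
move: H; rewrite pE -EFinM !lee_fin => H.
rewrite invfM mulrA ler_pdivlMr ?exprn_gt0// mulrC//.
Qed.

Definition exceeds (N : nat) (x : R) : set T :=
  [set w | exists2 i, (N <= i)%N & x < psum X i w / i%:R].

Lemma exceedsE N x : exceeds N x = \bigcup_M ~` survive_below N x M.
Proof.
apply/seteqP; split=> w /=.
  move=> [i Ni xi]; exists i => //= h.
  have := h i; rewrite Ni leqnn => /(_ isT); rewrite /below/=.
  by rewrite leNgt xi.
move=> [M _] /= /existsNP[i /not_implyP[/andP[Ni iM]]] /negP.
by rewrite -ltNge => xi; exists i.
Qed.

Lemma measurable_exceeds N x : measurable (exceeds N x).
Proof.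
rewrite exceedsE; apply: bigcup_measurable => M _; apply: measurableC.
by apply: measurable_survive; exact: measurable_below.
Qed.

Lemma survive_belowC_subset N x M : ~` survive_below N x M `<=` exceeds N x.
Proof. by rewrite exceedsE => w h; exists M. Qed.

Lemma hajek_renyi (N : nat) (x : R) : (0 < N)%N -> 0 < x ->
  (P (exceeds N x) <= (2 / (N%:R * x ^+ 2))%:E)%E.
Proof.
move=> N0 x0.
have mS M : measurable (~` survive_below N x M).
  apply: measurableC; apply: measurable_survive; exact: measurable_below.
have nd : nondecreasing_seq (fun M => ~` survive_below N x M).
  move=> M M' MM'; apply/subsetPset; apply: subsetC => w h i /andP[Ni iM].
  by apply: h; rewrite Ni (leq_trans iM).
have mU : measurable (\bigcup_M ~` survive_below N x M).
  by rewrite -exceedsE; exact: measurable_exceeds.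
rewrite exceedsE; apply: (cvge_to_le (nondecreasing_cvg_mu mS mU nd)).
near=> M; apply: hajek_renyi_finite => //; rewrite N0/=.
by near: M; exact: nbhs_infty_ge.
Unshelve. all: by end_near. Qed.

End maximal.

(** * Crossing a line *)

Section exponential.
Context {R : realType}.

Lemma expR_taylor (v : R) : `|v| <= 1 ->
  `|expR v - (1 + v + v ^+ 2 / 2)| <= 3 * expR 1 * cub v.
Proof.
move=> v1.
have bnd s : `|s| <= `|v| -> `|expR (0 + s)| <= expR 1.
  move=> sv; rewrite add0r ger0_norm ?expR_ge0// ler_expR.
  by apply: le_trans (ler_norm _) _; exact: le_trans v1.
have := taylor_cub (x := 0) (v := v) (@is_derive_expR R) (@is_derive_expR R)
  (@is_derive_expR R) bnd bnd.
rewrite add0r expR0 !mul1r.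
have -> : expR v - 1 - v - v ^+ 2 / 2 = expR v - (1 + v + v ^+ 2 / 2) by ring.
by have -> : 2 * expR 1 + expR 1 = 3 * expR 1 :> R by ring.
Qed.

Definition cap_cst (th : R) : R := 3 * expR 1 + 4 / th ^+ 3.

(** If |v| <= th, then A exp v <= 1, the cap is inactive and [expR_taylor] applies. If |v| > th, the
    difference is at most 2 + |v| + v^2, and 1, |v| and v^2 are each at most [cub v] / th^3 because
    th <= 1; hence the 4 in [cap_cst]. *)
Lemma capped_exp_taylor (th A v : R) : 0 < th -> th <= 1 ->
  0 <= A -> A <= expR (- th) ->
  `|Num.min 1 (A * expR v) - A * (1 + v + v ^+ 2 / 2)| <= cap_cst th * cub v.
Proof.
move=> th0 th1 A0 Ath.
have A1 : A <= 1 by apply: le_trans Ath _; rewrite expR_le1; lra.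
have c0 := cub_ge0 v.
have [vth|vth] := leP `|v| th.
  have -> : Num.min 1 (A * expR v) = A * expR v.
    apply/min_idPr; apply: le_trans (ler_pM A0 (expR_ge0 _) Ath (lexx _)) _.
    rewrite -expRD expR_le1; have := ler_norm v; lra.
  rewrite -mulrBr normrM (ger0_norm A0).
  apply: (@le_trans _ _ (1 * (3 * expR 1 * cub v))).
    by apply: ler_pM => //; apply: expR_taylor; exact: le_trans th1.
  rewrite mul1r ler_wpM2r// /cap_cst lerDl divr_ge0// exprn_ge0// ltW//.
have m0 : 0 <= Num.min 1 (A * expR v) by rewrite le_min ler01 mulr_ge0 ?expR_ge0.
have m1 : Num.min 1 (A * expR v) <= 1 by rewrite ge_min lexx.
have v0 := normr_ge0 v.
have h1 : `|Num.min 1 (A * expR v) - A * (1 + v + v ^+ 2 / 2)| <=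
    2 + `|v| + `|v| ^+ 2.
  have v2 : v ^+ 2 = `|v| ^+ 2 by rewrite real_normK ?num_real.
  have a2 : `|A * (1 + v + v ^+ 2 / 2)| <= 1 + `|v| + `|v| ^+ 2.
    rewrite normrM (ger0_norm A0) -[leRHS]mul1r; apply: ler_pM => //.
    apply: le_trans (ler_normD _ _) _; apply: lerD.
      by apply: le_trans (ler_normD _ _) _; rewrite normr1.
    rewrite v2 ger0_norm ?divr_ge0 ?exprn_ge0//.
    by have := exprn_ge0 2 v0; move: (`|v| ^+ 2) => z; lra.
  apply: le_trans (ler_normB _ _) _; rewrite ger0_norm//.
  by move: a2 m1; clear; lra.
apply: le_trans h1 _.
suff h2 : 2 + `|v| + `|v| ^+ 2 <= 4 / th ^+ 3 * cub v.
  apply: le_trans h2 _; rewrite ler_wpM2r// /cap_cst lerDr mulr_ge0// expR_ge0//.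
have v2 : v ^+ 2 = `|v| ^+ 2 by rewrite real_normK ?num_real.
rewrite /cub v2 mulrAC ler_pdivlMr ?exprn_gt0//.
move: v0 vth; move: `|v| => y y0 ty {v2 m0 m1 c0 Ath A1}.
have t2 : th ^+ 2 <= y ^+ 2 by rewrite lerXn2r ?nnegrE// ltW.
have t3 : th ^+ 3 <= y ^+ 3 by rewrite lerXn2r ?nnegrE// ltW.
have tt2 : th ^+ 3 <= th ^+ 2 by rewrite ler_wiXn2l// ltW.
have tt1 : th ^+ 2 <= th by rewrite -[leRHS]expr1 ler_wiXn2l// ltW.
have tt0 : 0 <= th ^+ 3 by rewrite exprn_ge0// ltW.
have tt20 : 0 <= th ^+ 2 by rewrite exprn_ge0// ltW.
have y20 : 0 <= y ^+ 2 by rewrite exprn_ge0.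
have y30 : 0 <= y ^+ 3 by rewrite exprn_ge0.
have a1 : y * th <= y ^+ 2 by rewrite expr2 ler_wpM2l// ltW.
have a2 : y * th ^+ 2 <= y ^+ 3 by rewrite (exprS y 2) ler_wpM2l.
have a3 : y ^+ 2 * th <= y ^+ 3 by rewrite (exprSr y 2) ler_wpM2l// ltW.
have [_|_] := leP (y ^+ 2) (y ^+ 3).
  have b1 : y * th ^+ 3 <= y ^+ 2.
    apply: le_trans (_ : y * th <= _) => //; rewrite ler_wpM2l//.
    exact: le_trans tt1.
  have b2 : y ^+ 2 * th ^+ 3 <= y ^+ 2.
    by rewrite ler_piMr// (le_trans tt2)// (le_trans tt1).
  by rewrite !mulrDl; move: tt2 t2 b1 b2; clear; lra.
have b1 : y * th ^+ 3 <= y ^+ 3.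
  by apply: le_trans a2; rewrite ler_wpM2l.
have b2 : y ^+ 2 * th ^+ 3 <= y ^+ 3.
  apply: le_trans a3; rewrite ler_wpM2l//; exact: le_trans tt1.
by rewrite !mulrDl; move: t3 b1 b2; clear; lra.
Qed.

End exponential.

(** * The capped exponential along the walk *)

Section crossing.
Context d (T : measurableType d) (R : realType) (P : probability T R).
Variable X : nat -> {RV P >-> R}.
Hypothesis Xindep : mutually_independent X.
Hypothesis Xident : identically_distributed X.
Hypothesis EX : (\int[P]_w (X 0%N w)%:E = 0)%E.
Hypothesis EX2 : (\int[P]_w (X 0%N w ^+ 2)%:E = 1)%E.

Local Notation L := (lindeberg (X 0%N)).

Variables (c th : R) (n : nat).
Hypothesis c0 : 0 < c.
Hypothesis th0 : 0 < th.
Hypothesis th1 : th <= 1.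
Hypothesis n0 : (0 < n)%N.

(* Up to the discount exp (- th), which absorbs the overshoot at a crossing,
   this is exp (- 2 mu g) for a walk with drift - mu = - c / sqrt n below its
   barrier by g = c i / sqrt n - s. *)
Definition barrier_exp (i : nat) (s : R) : R :=
  Num.min 1 (expR (2 * c * (s / Num.sqrt n%:R) - th - 2 * c ^+ 2 * i%:R / n%:R)).

Definition barrier_err : R :=
  ((2 * c ^+ 2) ^+ 2 / n%:R +
    cap_cst th * ((2 * c) ^+ 2 + (2 * c) ^+ 3) * L n) / n%:R.

Let nR0 : 0 < n%:R :> R. Proof. by rewrite ltr0n. Qed.
Let sn0 : 0 < Num.sqrt n%:R :> R. Proof. by rewrite sqrtr_gt0. Qed.

Lemma barrier_exp_ge0 i s : 0 <= barrier_exp i s.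
Proof. by rewrite le_min ler01 expR_ge0. Qed.

Lemma barrier_exp_le1 i s : barrier_exp i s <= 1.
Proof. by rewrite ge_min lexx. Qed.

Lemma measurable_barrier_exp i : measurable_fun [set: R] (barrier_exp i).
Proof.
apply: measurable_minr => //; apply: measurableT_comp => //.
apply: measurable_funB => //; apply: measurable_funB => //.
by apply: measurable_funM => //; exact: measurable_funM.
Qed.

Lemma barrier_err_ge0 : 0 <= barrier_err.
Proof.
apply: divr_ge0; last exact: ltW.
apply: addr_ge0; first by rewrite divr_ge0 ?sqr_ge0// ltW.
apply: mulr_ge0; last exact: lindeberg_ge0.
have c20 : 0 <= 2 * c by rewrite mulr_ge0// ltW.
apply: mulr_ge0; last by apply: addr_ge0; exact: exprn_ge0.
by rewrite addr_ge0 ?mulr_ge0 ?expR_ge0 ?invr_ge0 ?exprn_ge0// ltW.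
Qed.

Lemma below_barrierE i s : (0 < i)%N ->
  below (c / Num.sqrt n%:R) i s <->
  2 * c * (s / Num.sqrt n%:R) <= 2 * c ^+ 2 * i%:R / n%:R.
Proof.
move=> i0; have iR0 : 0 < i%:R :> R by rewrite ltr0n.
have -> : 2 * c ^+ 2 * i%:R / n%:R = 2 * c * (c * i%:R / n%:R) by field; rewrite gt_eqF.
rewrite ler_pM2l ?mulr_gt0// /below /= ler_pdivrMr// ler_pdivrMr//.
have -> : c * i%:R / n%:R * Num.sqrt n%:R = c / Num.sqrt n%:R * i%:R.
  by rewrite -{1}(@sqr_sqrtr _ n%:R) ?(ltW nR0)//; field; rewrite gt_eqF.
by [].
Qed.

Lemma barrier_exp_crossed i s : (0 < i)%N -> ~ below (c / Num.sqrt n%:R) i s ->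
  expR (- th) <= barrier_exp i s.
Proof.
move=> i0 /(below_barrierE _ i0) /negP; rewrite -ltNge => h.
rewrite le_min expR_le1 oppr_le0 (ltW th0)/= ler_expR.
by rewrite addrAC lerDr subr_ge0 ltW.
Qed.

(** With kap = 2 c^2 / n, the advancing line multiplies the exponential by exp (- kap), while the
    step multiplies it in mean by about 1 + kap, as v^2 / 2 has mean kap. The product lies between 1
    - kap^2 and 1, so the two effects cancel to first order. Being below the line gives A <= exp (-
    th), as [capped_exp_taylor] requires. *)
Lemma barrier_step i s : (0 < i)%N -> below (c / Num.sqrt n%:R) i s ->
  (\int[P]_w (barrier_exp i.+1 (s + X 0%N w))%:E <=
    (barrier_exp i s + barrier_err)%:E)%E /\
  ((barrier_exp i s)%:E <=
    \int[P]_w (barrier_exp i.+1 (s + X 0%N w))%:E + (barrier_err)%:E)%E.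
Proof.
move=> i0 /(below_barrierE _ i0) hs.
pose kap := 2 * c ^+ 2 / n%:R.
have kap0 : 0 <= kap by rewrite /kap divr_ge0 ?mulr_ge0 ?sqr_ge0 ?(ltW nR0) ?(ltW c0)//.
pose E := 2 * c * (s / Num.sqrt n%:R) - th - 2 * c ^+ 2 * i%:R / n%:R.
have Eth : E <= - th by rewrite /E addrAC gerDr subr_le0.
have bE : barrier_exp i s = expR E.
  by apply/min_idPr; rewrite expR_le1; move: Eth th0; lra.
pose A := expR (E - kap).
have A0 : 0 <= A by exact: expR_ge0.
have Ath : A <= expR (- th) by rewrite ler_expR; move: Eth kap0; lra.
pose v x := 2 * c * (x / Num.sqrt n%:R).
have bS x : barrier_exp i.+1 (s + x) = Num.min 1 (A * expR (v x)).
  rewrite /barrier_exp -expRD; congr (Num.min _ (expR _)).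
  by rewrite /E /kap /v -natr1; field; rewrite !gt_eqF.
have v2 x : v x ^+ 2 = 2 * kap * x ^+ 2.
  rewrite /v /kap !exprMn exprVn sqr_sqrtr ?(ltW nR0)//; field.
  by rewrite gt_eqF.
pose C := cap_cst th * ((2 * c) ^+ 2 + (2 * c) ^+ 3).
have C0 : 0 <= cap_cst th.
  by rewrite addr_ge0 ?mulr_ge0 ?expR_ge0 ?invr_ge0 ?exprn_ge0// ltW.
have T1 x : `|barrier_exp i.+1 (s + x) - A * (1 + v x + v x ^+ 2 / 2)| <=
    C / n%:R * (n%:R * cub (x / Num.sqrt n%:R)).
  rewrite bS; apply: le_trans (capped_exp_taylor _ th0 th1 A0 Ath) _.
  have -> : C / n%:R * (n%:R * cub (x / Num.sqrt n%:R)) =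
      cap_cst th * (((2 * c) ^+ 2 + (2 * c) ^+ 3) * cub (x / Num.sqrt n%:R)).
    by rewrite /C; field; rewrite gt_eqF.
  by rewrite ler_wpM2l// cubZ// mulr_ge0// ltW.
have errE : barrier_err = kap ^+ 2 + C / n%:R * L n.
  by rewrite /barrier_err /kap -/C; field; rewrite gt_eqF.
have AE : A * (1 + kap) <= expR E /\ expR E - kap ^+ 2 <= A * (1 + kap).
  have E1 : expR E <= 1 by rewrite expR_le1; move: Eth th0; lra.
  have -> : A * (1 + kap) = expR E * (expR (- kap) * (1 + kap)).
    by rewrite /A expRD; ring.
  have k1 : expR (- kap) * (1 + kap) <= 1.
    by rewrite expRN mulrC ler_pdivrMr ?expR_gt0// mul1r expR_ge1Dx.
  have k2 : 1 - kap ^+ 2 <= expR (- kap) * (1 + kap).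
    have -> : 1 - kap ^+ 2 = (1 - kap) * (1 + kap) by ring.
    by rewrite ler_wpM2r ?expR_ge1Dx ?addr_ge0.
  split; first by rewrite ler_piMr ?expR_ge0.
  apply: le_trans (ler_wpM2l (expR_ge0 _) k2).
  rewrite mulrBr mulr1 lerD2l lerN2 ler_piMl ?sqr_ge0//.
have mb : measurable_fun [set: R] (fun x => barrier_exp i.+1 (s + x)).
  apply: (measurableT_comp (measurable_barrier_exp i.+1)); exact: measurable_funD.
case: AE => AE1 AE2; rewrite bE errE; split.
  apply: (@le_trans _ _ (A + A * kap + C / n%:R * L n)%:E); last first.
    rewrite lee_fin addrA lerD2r; have := sqr_ge0 kap; move: AE1.
    by rewrite mulrDr mulr1; lra.
  apply: (@integral_le_quadratic _ _ _ _ (X 0%N) EX EX2 n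
    (fun x => barrier_exp i.+1 (s + x)) _ (A * (2 * c / Num.sqrt n%:R))) => // x.
    exact: barrier_exp_ge0.
  have := T1 x; rewrite ler_norml v2 => /andP[_].
  have -> : A * (1 + v x + 2 * kap * x ^+ 2 / 2) =
    A + A * (2 * c / Num.sqrt n%:R) * x + A * kap * x ^+ 2.
    by rewrite /v; field; rewrite gt_eqF.
  by rewrite lerBlDl.
apply: (@le_trans _ _ ((A + A * kap + (- (C / n%:R)) * L n) + (kap ^+ 2 + C / n%:R * L n))%:E).
  rewrite lee_fin; move: AE2; rewrite mulrDr mulr1 mulNr.
  by move: (C / n%:R * L n) => z; lra.
rewrite EFinD leeD2r//.
apply: (@integral_ge_quadratic _ _ _ _ (X 0%N) EX EX2 n
    (fun x => barrier_exp i.+1 (s + x)) _ (A * (2 * c / Num.sqrt n%:R))) => // x.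
  by rewrite barrier_exp_ge0 barrier_exp_le1.
have := T1 x; rewrite ler_norml v2 => /andP[+ _].
have -> : A * (1 + v x + 2 * kap * x ^+ 2 / 2) =
  A + A * (2 * c / Num.sqrt n%:R) * x + A * kap * x ^+ 2.
  by rewrite /v; field; rewrite gt_eqF.
by rewrite lerBrDl mulNr.
Qed.

End crossing.

Section hit.
Context {R : realType}.

Lemma hit_ge0 (c y : R) : 0 <= hit c y.
Proof. by rewrite le_min ler01 expR_ge0. Qed.

Lemma hit_le1 (c y : R) : hit c y <= 1.
Proof. by rewrite ge_min lexx. Qed.

Lemma continuous_hit (c : R) : continuous (hit c).
Proof.
move=> y; apply: (@continuous_min _ _ (cst 1) (fun y => expR (2 * c * (y - c)))).
  exact: cvg_cst.
apply: (@cvg_comp _ _ _ (fun y : R => 2 * c * (y - c)) expR _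
  (nbhs (2 * c * (y - c)))); last exact: continuous_expR.
apply: cvgM; first exact: cvg_cst.
by apply: cvgB; [exact: cvg_id|exact: cvg_cst].
Qed.

End hit.

(** * The crossing probability up to time K n *)

Section crossing_limit.
Context d (T : measurableType d) (R : realType) (P : probability T R).
Variable X : nat -> {RV P >-> R}.
Hypothesis Xindep : mutually_independent X.
Hypothesis Xident : identically_distributed X.
Hypothesis EX : (\int[P]_w (X 0%N w)%:E = 0)%E.
Hypothesis EX2 : (\int[P]_w (X 0%N w ^+ 2)%:E = 1)%E.

Local Notation L := (lindeberg (X 0%N)).

Let W n w : R := psum X n w / Num.sqrt n%:R.

Let mW n : measurable_fun [set: T] (W n).
Proof. by apply: measurable_funM => //; exact: measurable_psum. Qed.

Lemma hit_cvg (c : R) : 0 < c ->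
  (\int[P]_w (hit c (W n w))%:E @[n --> \oo] --> (2 * (1 - Phi c))%:E)%E.
Proof.
move=> c0.
have mWn n : isMeasurableFun _ _ _ _ (W n) by split; exact: mW.
pose V n : {RV P >-> R} := HB.pack (W n) (mWn n).
pose idR : measurableTypeR R -> R := idfun.
have mid : isMeasurableFun _ _ _ _ idR by split; exact: measurable_id.
pose Z : {RV normal_prob (0 : R) 1 >-> R} := HB.pack idR mid.
have cvgV : cvg_in_distribution V Z.
  apply: cvg_in_distribution_tail => b.
  have -> : tailp Z b = 1 - Phi b.
    rewrite /tailp; have := normal_prob_gt b; move=> E.
    have -> : ccdf Z b = (1 - Phi b)%:E by rewrite -E.
    by [].
  under eq_fun do rewrite tailpE; exact: clt.
have := cvgV (hit c) (@continuous_hit _ c).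
have hb : bounded_fun (hit c).
  exists 1; split; first exact: num_real.
  move=> M M1 y _ /=; rewrite ger0_norm ?hit_ge0//.
  by apply: le_trans (hit_le1 _ _) _; exact: ltW.
move=> /(_ hb); rewrite unlock.
by rewrite -(integral_hit c0).
Qed.

Variables (c : R).
Hypothesis c0 : 0 < c.

Let H n : R := fine (\int[P]_w (hit c (W n w))%:E)%E.

Let HE n : (\int[P]_w (hit c (W n w))%:E = (H n)%:E)%E.
Proof.
rewrite fineK//; apply: integrable_fin_num => //.
have mh : measurable_fun [set: T] (fun w => hit c (W n w)).
  apply: (measurableT_comp _ (mW n)).
  by apply: continuous_measurable_fun; exact: continuous_hit.
apply: (@le_integrable _ _ _ _ _ _ _ (EFin \o cst 1)) => //.
- exact/measurable_EFinP.
- by move=> w _ /=; rewrite lee_fin ger0_norm ?hit_ge0// normr1 hit_le1.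
- exact: finite_measure_integrable_cst.
Qed.

(** At time n the exponent is - th + 2 c (W_n - c), so only the discount separates the two
    functions. *)
Lemma barrier_exp_start (th : R) (n : nat) s : 0 < th -> (0 < n)%N ->
  expR (- th) * hit c (s / Num.sqrt n%:R) <= barrier_exp c th n n s <=
  hit c (s / Num.sqrt n%:R).
Proof.
move=> th0 n0; have nR0 : 0 < n%:R :> R by rewrite ltr0n.
rewrite /barrier_exp /hit.
set y := s / Num.sqrt n%:R.
have -> : 2 * c * y - th - 2 * c ^+ 2 * n%:R / n%:R = - th + 2 * c * (y - c).
  by field; rewrite gt_eqF.
have t1 : expR (- th) <= 1 by rewrite expR_le1 oppr_le0 ltW.
rewrite expRD; have := expR_ge0 (2 * c * (y - c)); move: (expR (2 * c * (y - c))) => z z0.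
have t0 := expR_ge0 (- th).
apply/andP; split.
  rewrite le_min ler_wpM2l ?ge_min ?lexx ?orbT// andbT.
  apply: le_trans (_ : 1 * 1 <= _); last by rewrite mulr1.
  by apply: ler_pM => //; rewrite ?le_min ?ler01 ?z0 ?ge_min ?lexx.
by rewrite le_min ge_min lexx/= ge_min ler_piMl ?orbT.
Qed.

(** Split at half the height of the line. Below it the exponent is at most - c^2 K, and exp (- u) <=
    1/u. Above it the cap 1 is dominated by a quadratic, as in Chebyshev's inequality. *)
Lemma barrier_exp_end (th : R) (n K : nat) s : 0 < th -> (0 < n)%N -> (0 < K)%N ->
  barrier_exp c th n (K * n) s <=
  (c ^+ 2 * K%:R)^-1 + 4 / (n%:R * (c * K%:R) ^+ 2) * s ^+ 2.
Proof.
move=> th0 n0 K0.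
have nR0 : 0 < n%:R :> R by rewrite ltr0n.
have KR0 : 0 < K%:R :> R by rewrite ltr0n.
have sn0 : 0 < Num.sqrt n%:R :> R by rewrite sqrtr_gt0.
have c20 : 0 < c ^+ 2 * K%:R by rewrite mulr_gt0 ?exprn_gt0.
set y := s / Num.sqrt n%:R.
have y2 : y ^+ 2 = s ^+ 2 / n%:R by rewrite /y expr_div_n sqr_sqrtr// ltW.
have -> : 4 / (n%:R * (c * K%:R) ^+ 2) * s ^+ 2 = 4 * y ^+ 2 / (c * K%:R) ^+ 2.
  by rewrite y2; field; rewrite !gt_eqF.
have cK0 : 0 < c * K%:R by rewrite mulr_gt0.
rewrite /barrier_exp -/y.
have -> : 2 * c ^+ 2 * (K * n)%:R / n%:R = 2 * c * (c * K%:R).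
  by rewrite natrM; field; rewrite gt_eqF.
have [yc|yc] := leP y (c * K%:R / 2).
  apply: (@le_trans _ _ (c ^+ 2 * K%:R)^-1); last first.
    rewrite lerDl; apply: divr_ge0; last exact: sqr_ge0.
    by apply: mulr_ge0 => //; exact: sqr_ge0.
  rewrite ge_min; apply/orP; right.
  apply: (@le_trans _ _ (expR (- (c ^+ 2 * K%:R)))).
    rewrite ler_expR.
    have h : 2 * c * y <= 2 * c * (c * K%:R / 2) by rewrite ler_wpM2l// mulr_ge0// ltW.
    have e1 : 2 * c * (c * K%:R / 2) = c ^+ 2 * K%:R by field.
    have e2 : 2 * c * (c * K%:R) = 2 * (c ^+ 2 * K%:R) by ring.
    by rewrite e2; rewrite e1 in h; lra.
  rewrite expRN lef_pV2 ?posrE ?expR_gt0//.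
  by apply: le_trans (expR_ge1Dx _); rewrite lerDr.
rewrite ge_min; apply/orP; left.
apply: (@le_trans _ _ (4 * y ^+ 2 / (c * K%:R) ^+ 2)); last by rewrite lerDr invr_ge0 ltW.
rewrite ler_pdivlMr ?exprn_gt0// mul1r.
have -> : (c * K%:R) ^+ 2 = 4 * (c * K%:R / 2) ^+ 2 by field.
rewrite ler_wpM2l// lerXn2r ?nnegrE; [by []|lra|lra|lra].
Qed.

Definition barrier_tot (th : R) n : R := (2 * c ^+ 2) ^+ 2 / n%:R +
    cap_cst th * ((2 * c) ^+ 2 + (2 * c) ^+ 3) * L n.

Lemma barrier_tot_cvg0 th : barrier_tot th n @[n --> \oo] --> 0.
Proof.
rewrite -[X in _ --> X]addr0; apply: cvgD.
  rewrite -[X in _ --> X](mulr0 ((2 * c ^+ 2) ^+ 2)); apply: cvgM; first exact: cvg_cst.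
  apply/gtr0_cvgV0; last exact: cvgr_idn.
  by near=> n; rewrite ltr0n; near: n; exact: nbhs_infty_gt.
rewrite -[X in _ --> X](mulr0 (cap_cst th * ((2 * c) ^+ 2 + (2 * c) ^+ 3))).
apply: cvgM; first exact: cvg_cst.
exact: lindeberg_cvg0.
Unshelve. all: by end_near. Qed.

(** At a crossing the value is at least exp (- th) and at most 1: these are the two choices of [a].
    The upper bound discards the survivors; the lower one estimates them at time K n by
    [barrier_exp_end], which integrates to (1 + 4) / (c^2 K). *)
Lemma crossing_bounds (th : R) (n K : nat) : 0 < th -> th <= 1 -> (0 < n)%N -> (0 < K)%N ->
  let p := fine (P (~` survive X n (below (c / Num.sqrt n%:R)) (K * n))) in
  expR (- th) * p <= H n + K%:R * barrier_tot th n /\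
  expR (- th) * H n <= 5 / (c ^+ 2 * K%:R) + p + K%:R * barrier_tot th n.
Proof.
move=> th0 th1 n0 K0 p.
have nR0 : 0 < n%:R :> R by rewrite ltr0n.
have KR0 : 0 < K%:R :> R by rewrite ltr0n.
have nK : (n <= K * n)%N by rewrite leq_pmull.
set D := below (c / Num.sqrt n%:R) in p *.
have mD i : measurable (D i) by exact: measurable_below.
have mS i : measurable (survive X n D i) by exact: measurable_survive.
have pE : P (~` survive X n D (K * n)) = p%:E.
  by rewrite fineK// fin_num_measure//; exact: measurableC.
have mphi := measurable_barrier_exp c th n.
have phi0 := barrier_exp_ge0 c th n.
pose er := barrier_err X c th n.
have er0 (i : nat) : 0 <= (fun=> er) i by apply: barrier_err_ge0.
have ertot : er = barrier_tot th n / n%:R by [].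
have sum_er : \sum_(n <= i < K * n) er <= K%:R * barrier_tot th n.
  rewrite sumr_const_nat -[leLHS]mulr_natr.
  have -> : K%:R * barrier_tot th n = er * (K * n)%:R.
    by rewrite ertot natrM; field; rewrite gt_eqF.
  by rewrite ler_wpM2l ?ler_nat ?leq_subr//; exact: (er0 0%N).
have step i s : (n <= i < K * n)%N -> D i s -> _ :=
  fun ni Ds => @barrier_step _ _ _ P X EX EX2 c th n c0 th0 th1 n0 i s
    (leq_trans n0 (proj1 (andP ni))) Ds.
have mstart : measurable_fun [set: T] (fun w => (barrier_exp c th n n (psum X n w))%:E).
  by apply/measurable_EFinP; apply: (measurableT_comp (mphi n)); exact: measurable_psum.
have mhit : measurable_fun [set: T] (fun w => (hit c (W n w))%:E).
  apply/measurable_EFinP; apply: (measurableT_comp _ (mW n)).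
  by apply: continuous_measurable_fun; exact: continuous_hit.
split.
  have h := @stopped_upper _ _ _ P X n D mD Xindep Xident (barrier_exp c th n)
    (fun=> er) (expR (- th)) mphi phi0 er0 (expR_ge0 _) (K * n)%N nK.
  rewrite -lee_fin EFinM -pE.
  apply: le_trans (le_trans (leeDr _ _) (h _ _)) _.
  - by apply: integral_ge0 => w _; rewrite lee_fin.
  - by move=> i s ni Ds; have [] := step i s ni Ds.
  - move=> i s ni; apply: barrier_exp_crossed => //; exact: leq_trans ni.
  - rewrite EFinD; apply: leeD; last by rewrite lee_fin.
    rewrite -HE; apply: ge0_le_integral => //.
    + by move=> w _; rewrite lee_fin.
    + by move=> w _; rewrite lee_fin; have /andP[] := barrier_exp_start (psum X n w) th0 n0.
have h := @stopped_lower _ _ _ P X n D mD Xindep Xident (barrier_exp c th n)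
    (fun=> er) 1 mphi phi0 er0 (K * n)%N nK.
rewrite -lee_fin !EFinD EFinM -HE -pE -ge0_integralZl_EFin//; last first.
  by move=> w _; rewrite lee_fin hit_ge0.
apply: (@le_trans _ _ (\int[P]_w (barrier_exp c th n n (psum X n w))%:E)%E).
  apply: ge0_le_integral => //.
  - by move=> w _; rewrite -EFinM lee_fin mulr_ge0 ?expR_ge0 ?hit_ge0.
  - exact: measurable_funeM.
  - by move=> w _; rewrite -EFinM lee_fin; have /andP[] := barrier_exp_start (psum X n w) th0 n0.
apply: le_trans (h _ _) _.
- by move=> i s ni Ds; have [] := step i s ni Ds.
- by move=> i s _ _; exact: barrier_exp_le1.
rewrite mul1e; apply: leeD; last by rewrite lee_fin.
rewrite leeD2r//.
have mend : measurable_fun [set: T]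
    (fun w => (barrier_exp c th n (K * n) (psum X (K * n) w))%:E).
  by apply/measurable_EFinP; apply: (measurableT_comp (mphi _)); exact: measurable_psum.
pose A := (c ^+ 2 * K%:R)^-1; pose B := 4 / (n%:R * (c * K%:R) ^+ 2).
have A0 : 0 <= A by rewrite invr_ge0 mulr_ge0 ?sqr_ge0 ?ltW.
have B0 : 0 <= B by rewrite divr_ge0 ?mulr_ge0 ?sqr_ge0 ?ltW.
apply: (@le_trans _ _ (\int[P]_w (A%:E + B%:E * (psum X (K * n) w ^+ 2)%:E))%E).
  apply: (@le_trans _ _ (\int[P]_w (barrier_exp c th n (K * n) (psum X (K * n) w))%:E)%E).
    by apply: ge0_subset_integral => // w _; rewrite lee_fin.
  apply: ge0_le_integral => //.
  - by move=> w _; rewrite lee_fin.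
  - apply: emeasurable_funD => //; apply: measurable_funeM.
    by apply/measurable_EFinP; apply: measurable_funX; exact: measurable_psum.
  - by move=> w _; rewrite -EFinM -EFinD lee_fin; exact: barrier_exp_end.
have msq : measurable_fun [set: T] (fun w => (psum X (K * n) w ^+ 2)%:E).
  by apply/measurable_EFinP; apply: measurable_funX; exact: measurable_psum.
rewrite ge0_integralD//; last 2 first.
- by move=> w _; rewrite -EFinM lee_fin mulr_ge0 ?sqr_ge0.
- exact: measurable_funeM.
rewrite ge0_integralZl_EFin//; last by move=> w _; rewrite lee_fin sqr_ge0.
have -> : (\int[P]__ A%:E = A%:E)%E.
  by have := expectation_cst P A; rewrite unlock.
apply: (@le_trans _ _ (A%:E + B%:E * (K * n)%:R%:E)%E).
  by rewrite leeD2l// lee_wpmul2l ?lee_fin//; exact: integral_psum_sqr.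
rewrite -EFinM -EFinD lee_fin le_eqVlt; apply/orP; left; apply/eqP.
by rewrite /A /B natrM; field; rewrite !gt_eqF.
Qed.

End crossing_limit.

(** * Letting the horizon K n grow *)

Section exceedance_limit.
Context d (T : measurableType d) (R : realType) (P : probability T R).
Variable X : nat -> {RV P >-> R}.
Hypothesis Xindep : mutually_independent X.
Hypothesis Xident : identically_distributed X.
Hypothesis EX : (\int[P]_w (X 0%N w)%:E = 0)%E.
Hypothesis EX2 : (\int[P]_w (X 0%N w ^+ 2)%:E = 1)%E.

Lemma exceeds_sandwich (c : R) (n K : nat) : 0 < c -> (0 < n)%N -> (0 < K)%N ->
  let x := c / Num.sqrt n%:R in
  let p := fine (P (~` survive X n (below x) (K * n))) in
  p <= fine (P (exceeds X n x)) /\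
  fine (P (exceeds X n x)) <= p + 2 / (c ^+ 2 * K%:R).
Proof.
move=> c0 n0 K0 x p.
have nR0 : 0 < n%:R :> R by rewrite ltr0n.
have KR0 : 0 < K%:R :> R by rewrite ltr0n.
have x0 : 0 < x by rewrite divr_gt0// sqrtr_gt0.
have mE N : measurable (exceeds X N x) by exact: measurable_exceeds.
have mS : measurable (~` survive X n (below x) (K * n)).
  apply: measurableC; apply: measurable_survive; exact: measurable_below.
have fE N : P (exceeds X N x) = (fine (P (exceeds X N x)))%:E.
  by rewrite fineK// fin_num_measure.
have fS : P (~` survive X n (below x) (K * n)) = p%:E.
  by rewrite fineK// fin_num_measure.
split.
  rewrite -lee_fin -fE -fS; apply: le_measure; rewrite ?inE//.
  exact: survive_belowC_subset.
rewrite -lee_fin -fE EFinD -fS.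
apply: (@le_trans _ _ (P ((~` survive X n (below x) (K * n)) `|` exceeds X (K * n) x))).
  apply: le_measure; rewrite ?inE//; first exact: measurableU.
  move=> w [i ni xi]; have [iK|Ki] := leqP i (K * n); last first.
    by right; exists i => //; exact: ltnW.
  left => /(_ i); rewrite ni iK => /(_ isT); rewrite /below/=.
  by rewrite leNgt xi.
apply: (le_trans (measureU2 _ _ _)) => //; rewrite leeD2l//.
have KN0 : (0 < K * n)%N by rewrite muln_gt0 K0.
apply: le_trans (hajek_renyi Xindep Xident EX EX2 KN0 x0) _.
rewrite lee_fin le_eqVlt; apply/orP; left; apply/eqP.
rewrite /x expr_div_n sqr_sqrtr ?(ltW nR0)// natrM; field.
by rewrite !gt_eqF.
Qed.

Lemma exceeds_cvg (c : R) : 0 < c ->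
  fine (P (exceeds X n (c / Num.sqrt n%:R))) @[n --> \oo] --> 2 * (1 - Phi c).
Proof.
move=> c0; apply/cvgrPdist_le => e0 e00.
(* The lower bound spends all six parts: three on e * H with H <= 3, and one each on 5 / (c^2 K), on
   the accumulated step errors and on the convergence of H. *)
pose e : R := Num.min 1 (e0 / 6).
have e_gt0 : 0 < e by rewrite lt_min ltr01 divr_gt0.
have e1 : e <= 1 by rewrite ge_min lexx.
have e5 : 6 * e <= e0 by rewrite mulrC -ler_pdivlMr// ge_min lexx orbT.
pose th := e / (1 + e).
have th0 : 0 < th by rewrite divr_gt0//; lra.
have the : th <= e by rewrite ler_pdivrMr; [nra|lra].
have th1 : th <= 1 by lra.
have eth : 1 - e <= expR (- th).
  by apply: le_trans (expR_ge1Dx _); lra.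
have [K K0 HK] : exists2 K, (0 < K)%N & 5 / (c ^+ 2 * K%:R) <= e.
  have h : 0 <= 5 / (c ^+ 2 * e) by rewrite divr_ge0// mulr_ge0 ?sqr_ge0// ltW.
  exists (Num.truncn (5 / (c ^+ 2 * e))).+1 => //.
  have /andP[_] := truncn_itv h; set k := (Num.truncn (5 / (c ^+ 2 * e))).+1%:R => hk.
  have k0 : 0 < k by exact: le_lt_trans h hk.
  have ce : 0 < c ^+ 2 * e by rewrite mulr_gt0 ?exprn_gt0.
  move: hk; rewrite ltr_pdivrMr// => hk.
  rewrite ler_pdivrMr ?mulr_gt0 ?exprn_gt0//; apply: ltW.
  by apply: lt_le_trans hk _; rewrite le_eqVlt; apply/orP; left; apply/eqP; ring.
have /fine_cvgP[_ Hc] := hit_cvg Xindep Xident EX EX2 c0.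
have K0R : 0 < K%:R :> R by rewrite ltr0n.
near=> n.
have n0 : (0 < n)%N by near: n; exact: nbhs_infty_gt.
have H1 : `|2 * (1 - Phi c) -
    fine (\int[P]_w (hit c (psum X n w / Num.sqrt n%:R))%:E)%E| <= e.
  by near: n; move/cvgrPdist_le : Hc; apply.
have H2 : K%:R * barrier_tot X c th n <= e.
  rewrite mulrC -ler_pdivlMr//.
  near: n; have /cvgrPdist_le := barrier_tot_cvg0 EX2 c th.
  move=> /(_ (e / K%:R)); rewrite divr_gt0// => /(_ isT).
  by apply: filterS => n; rewrite sub0r normrN; apply: le_trans; exact: ler_norm.
have [B1 B2] := crossing_bounds Xindep Xident EX EX2 c0 th0 th1 n0 K0.
have [S1 S2] := exceeds_sandwich c0 n0 K0.
move: B1 B2 S1 S2 H1.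
set p := fine (P (~` _)); set q := fine (P (exceeds _ _ _)).
set H := fine (\int[P]_w _)%E => B1 B2 S1 S2 H1.
have p0 : 0 <= p by exact: fine_ge0.
have H0 : 0 <= H.
  by apply: fine_ge0; apply: integral_ge0 => w _; rewrite lee_fin hit_ge0.
have h2 : 2 / (c ^+ 2 * K%:R) <= e.
  apply: le_trans HK; rewrite ler_wpM2r ?ler_nat// invr_ge0 mulr_ge0 ?sqr_ge0//.
have p1 : p <= 1.
  rewrite -lee_fin fineK ?probability_le1//; last first.
    by rewrite fin_num_measure//; apply: measurableC; apply: measurable_survive;
      exact: measurable_below.
  by apply: measurableC; apply: measurable_survive; exact: measurable_below.
have hle2 : 2 * (1 - Phi c) <= 2 by have := Phi_ge0 c; lra.
move: H1; rewrite ler_norml => /andP[H1 H1'].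
have pe : (1 - e) * p <= H + K%:R * barrier_tot X c th n.
  by apply: le_trans B1; rewrite ler_wpM2r.
have He : (1 - e) * H <= 5 / (c ^+ 2 * K%:R) + p + K%:R * barrier_tot X c th n.
  by apply: le_trans B2; rewrite ler_wpM2r.
have ep : e * p <= e by rewrite ler_piMr// ltW.
have eH : e * H <= e * 3 by rewrite ler_wpM2l ?(ltW e_gt0)//; lra.
rewrite ler_norml; apply/andP; split; lra.
Unshelve. all: by end_near. Qed.

End exceedance_limit.

(** * The tail supremum *)

Section tail_supremum.
Context d (T : measurableType d) (R : realType) (P : probability T R).
Variable X : nat -> {RV P >-> R}.
Hypothesis Xindep : mutually_independent X.
Hypothesis Xident : identically_distributed X.
Hypothesis EX : (\int[P]_w (X 0%N w)%:E = 0)%E.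
Hypothesis EX2 : (\int[P]_w (X 0%N w ^+ 2)%:E = 1)%E.

Lemma lt_tail_sup n (x : R) w : (x%:E < tail_sup X n w)%E <-> exceeds X n x w.
Proof.
split.
  move=> /ereal_sup_gt[_ [i /= ni <-]]; rewrite lte_fin => xi.
  by exists i.
move=> [i ni xi]; apply: (@lt_le_trans _ _ (sample_mean X i w)%:E).
  by rewrite lte_fin.
by apply: ereal_sup_ubound; exists i.
Qed.

Lemma tail_sup_gtNy n w : (-oo < tail_sup X n w)%E.
Proof.
apply: (@lt_le_trans _ _ (sample_mean X n w)%:E); first exact: ltNyr.
by apply: ereal_sup_ubound; exists n => /=.
Qed.

Let unbounded n : set T := [set w | tail_sup X n w = +oo%E].

Let measurable_unbounded n : measurable (unbounded n).
Proof.
rewrite (_ : unbounded n = tail_sup X n @^-1` [set +oo%E]); last by [].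
rewrite -[Y in measurable Y]setTI; exact: measurable_tail_sup.
Qed.

(** An infinite supremum exceeds every level x, and [hajek_renyi] bounds the probability of that by
    2 / (n x^2). *)
Let unbounded0 n : (0 < n)%N -> P (unbounded n) = 0%E.
Proof.
move=> n0; apply/eqP; rewrite eq_le measure_ge0 andbT.
apply/lee_addgt0Pr => e e0; rewrite add0e.
(* With x >= 1, x^2 >= x, so e x >= 2 is enough. *)
pose x : R := Num.max 1 (2 / e).
have x1 : 1 <= x by rewrite le_max lexx.
have x0 : 0 < x by exact: lt_le_trans x1.
apply: (@le_trans _ _ (P (exceeds X n x))).
  apply: le_measure; rewrite ?inE//; first exact: measurable_exceeds.
  by move=> w wy; apply/lt_tail_sup; rewrite wy ltry.
apply: (le_trans (hajek_renyi Xindep Xident EX EX2 n0 x0)).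
rewrite lee_fin ler_pdivrMr ?mulr_gt0 ?ltr0n ?exprn_gt0//.
have h : 2 <= e * x by rewrite mulrC -ler_pdivrMr// le_max lexx orbT.
apply: (le_trans h); rewrite ler_wpM2l// ?(ltW e0)//.
apply: (@le_trans _ _ (1 * x ^+ 2)).
  by rewrite mul1r expr2 ler_peMl// ltW.
by rewrite ler_wpM2r ?sqr_ge0// ler1n.
Qed.

Lemma tail_sup_fin_num n : (0 < n)%N ->
  {ae P, forall w, tail_sup X n w \is a fin_num}.
Proof.
move=> n0; exists (unbounded n); split; [exact: measurable_unbounded|exact: unbounded0|].
move=> w /= /negP; rewrite fin_numElt tail_sup_gtNy/= ltey negbK => /eqP.
by [].
Qed.

(** As c > 0 and [fine] sends an infinite supremum to 0, the event on the left misses exactly the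
    points where the supremum is infinite, a null set. *)
Lemma tailp_scaled_tail_sup n (c : R) : (0 < n)%N -> 0 < c ->
  tailp (scaled_tail_sup X n : {RV P >-> R}) c =
  fine (P (exceeds X n (c / Num.sqrt n%:R))).
Proof.
move=> n0 c0; rewrite tailpE.
have sn0 : 0 < Num.sqrt n%:R :> R by rewrite sqrtr_gt0 ltr0n.
set A := [set w | _]; set x := c / _.
have x0 : 0 < x by rewrite divr_gt0.
have AE : A = exceeds X n x `\` unbounded n.
  apply/seteqP; split => w; rewrite /A /= /scaled_tail_sup.
    rewrite mulrC -ltr_pdivrMr// => h.
    have fn : tail_sup X n w \is a fin_num.
      case: (tail_sup X n w) h => [r//| |] /=; by rewrite ltNge (ltW x0).
    split; last by move=> wy; rewrite wy in fn.
    by apply/lt_tail_sup; rewrite -(fineK fn) lte_fin.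
  move=> [/lt_tail_sup h wy]; rewrite mulrC -ltr_pdivrMr//.
  have fn : tail_sup X n w \is a fin_num.
    by rewrite fin_numElt tail_sup_gtNy/= ltey; apply/eqP.
  by rewrite -lte_fin fineK.
congr fine; rewrite AE; apply/eqP; rewrite eq_le; apply/andP; split.
  apply: le_measure; rewrite ?inE; last by move=> w [].
  - by apply: measurableD; [exact: measurable_exceeds|exact: measurable_unbounded].
  - exact: measurable_exceeds.
rewrite -[leRHS]adde0 -(unbounded0 n0).
have mE : measurable (exceeds X n x) by exact: measurable_exceeds.
have mD : measurable (exceeds X n x `\` unbounded n) by exact: measurableD.
apply: le_trans (measureU2 _ mD (measurable_unbounded n)).
apply: le_measure; rewrite ?inE//; first exact: measurableU.
by move=> w wE; have [wu|wu] := pselect (unbounded n w); [right|left].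
Qed.

End tail_supremum.

(** * Tails of the folded normal law, and the conclusion *)

Section folded_normal.
Context {R : realType} d' (T' : measurableType d') (P' : probability T' R).
Variable Z : {RV P' >-> R}.
Hypothesis Znormal : standard_normal Z.

Lemma tailp_norm_normal (c : R) : 0 < c ->
  tailp (Num.norm \o Z : {RV P' >-> R}) c = 2 * (1 - Phi c).
Proof.
move=> c0; rewrite tailpE.
pose A : set T' := Z @^-1` `]c, +oo[; pose B : set T' := Z @^-1` `]-oo, - c[.
have E1 : P' A = (1 - Phi c)%:E.
  by rewrite -normal_prob_gt -Znormal.
have E2 : P' B = (1 - Phi c)%:E.
  transitivity (normal_prob (0 : R) 1 `]-oo, - c[); first by rewrite -Znormal.
  rewrite -PhiN EFin_Phi /normal_prob integral_itv_bndo_bndc//.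
  by apply: measurable_funTS; apply/measurable_EFinP; exact: measurable_normal_pdf.
have -> : [set w | c < (Num.norm \o Z) w] = A `|` B.
  apply/seteqP; split=> w; rewrite /A /B /= !in_itv/= andbT lter_normr ltrNr.
    by move/orP.
  by move=> /orP.
have U : P' (A `|` B) = (P' A + P' B)%E.
  apply: measureU.
  - by rewrite -[Y in measurable Y]setTI; exact: measurable_funPT.
  - by rewrite -[Y in measurable Y]setTI; exact: measurable_funPT.
  - by apply/seteqP; split=> w //; rewrite /A /B /= !in_itv/= andbT => -[h1 h2]; lra.
by rewrite U E1 E2 /=; ring.
Qed.

End folded_normal.

Lemma tailp_le1 d (T : measurableType d) (R : realType) (P : probability T R)
  (V : {RV P >-> R}) c : tailp V c <= 1.
Proof. by rewrite -lee_fin fineK ?probability_le1// fin_num_measure. Qed.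

Lemma tailp_le d (T : measurableType d) (R : realType) (P : probability T R)
  (V : {RV P >-> R}) (a b : R) : a <= b -> tailp V b <= tailp V a.
Proof.
move=> ab; apply: fine_le; rewrite ?fin_num_measure//.
exact: ccdf_nonincreasing.
Qed.

Theorem theorem2 (R : realType)
    (d : measure_display) (T : measurableType d) (P : probability T R)
    (X : nat -> {RV P >-> R})
    (Xindep : mutually_independent X)
    (Xident : identically_distributed X)
    (Xmean : ('E_P[X 0%N] = 0)%E)
    (Xvar : (variance P (X 0%N) = 1)%E)
    (Xmoment : exists2 p : R, 2 < p &
      ('E_P[(fun w => `|X 0%N w| `^ p)%R] < +oo)%E)
    (d' : measure_display) (T' : measurableType d') (P' : probability T' R)
    (Z : {RV P' >-> R}) (Znormal : standard_normal Z) :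
  (forall n : nat, (0 < n)%N ->
     {ae P, forall w, tail_sup X n w \is a fin_num}) /\
  cvg_in_distribution
    (fun n => scaled_tail_sup X n : {RV P >-> R})
    (Num.norm \o Z : {RV P' >-> R}).
Proof.
have EX : (\int[P]_w (X 0%N w)%:E = 0)%E by rewrite -Xmean unlock.
have EX2 : (\int[P]_w (X 0%N w ^+ 2)%:E = 1)%E.
  rewrite -Xvar /variance covariance.unlock Xmean expectation.unlock.
  apply: eq_integral => w _; congr EFin.
  by rewrite -[RHS]/((X 0%N w - 0) * (X 0%N w - 0)) subr0 expr2.
split; first by move=> n n0; exact: tail_sup_fin_num.
have cvg_pos c : 0 < c -> tailp (scaled_tail_sup X n : {RV P >-> R}) c @[n --> \oo] -->
    2 * (1 - Phi c).
  move=> c0; apply: cvg_trans (exceeds_cvg Xindep Xident EX EX2 c0).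
  apply: near_eq_cvg; near=> n; apply/esym/tailp_scaled_tail_sup => //.
  by near: n; exact: nbhs_infty_gt.
apply: cvg_in_distribution_tail => c.
have [c0|c0] := ltP 0 c; first by rewrite tailp_norm_normal//; exact: cvg_pos.
(* For c <= 0 both tails lie between their value at a small c' > 0 and 1. Since 2 (1 - Phi c') tends
   to 1 as c' tends to 0, the limiting tail is 1 and the tails at c converge to it. *)
have Phi0 : Phi 0 = 2^-1 :> R by have := @PhiN R 0; rewrite oppr0; lra.
have small (e : R) : 0 < e -> exists2 c', 0 < c' & 1 - e <= 2 * (1 - Phi c').
  move=> e0; have /cvgrPdist_le/(_ (e / 2)) := @continuous_Phi R 0.
  rewrite divr_gt0// => /(_ isT)[/= r r0 Hr].
  have r2 : 0 < r / 2 by rewrite divr_gt0.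
  exists (r / 2) => //.
  have : `|Phi 0 - Phi (r / 2)| <= e / 2.
    by apply: Hr; rewrite /= sub0r normrN gtr0_norm//; lra.
  by rewrite Phi0 ler_norml => /andP[h _]; lra.
have limit1 : tailp (Num.norm \o Z : {RV P' >-> R}) c = 1.
  apply/eqP; rewrite eq_le tailp_le1/=; apply/ler_addgt0Pr => e e0.
  have [c' c'0 hc'] := small e e0.
  rewrite -lerBlDr (le_trans hc')// -(tailp_norm_normal Znormal c'0).
  by apply: tailp_le; exact: le_trans (ltW c'0).
rewrite limit1; apply/cvgrPdist_le => e e0.
have e2 : 0 < e / 2 by rewrite divr_gt0.
have [c' c'0 hc'] := small _ e2.
have /cvgrPdist_le /(_ _ e2) := cvg_pos _ c'0.
apply: filterS => n h.
have h1 := tailp_le1 (scaled_tail_sup X n : {RV P >-> R}) c.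
rewrite ger0_norm ?subr_ge0// lerBlDr.
have h2 := tailp_le (scaled_tail_sup X n : {RV P >-> R}) (le_trans c0 (ltW c'0)).
rewrite [e in leRHS]splitr -addrA -lerBlDl; apply: (le_trans hc').
apply: le_trans (_ : _ <= e / 2 + tailp (scaled_tail_sup X n : {RV P >-> R}) c') _.
  by rewrite -lerBlDr; apply: le_trans h; exact: ler_norm.
by rewrite lerD2l.
Unshelve. all: by end_near. Qed.
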